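(* Let $\kappa$ be a regular uncountable cardinal, $\chi<\kappa$ an infinite cardinal, $U\subseteq{}^{<\kappa}\kappa$ a downward-closed $\kappa$-tree, and suppose $\mathrm{P}_{14}(\kappa,\sqsubseteq,1,\{E^\kappa_{\ge\chi}\})$ holds. If $\lambda^{<\chi}<\kappa$ for all $\lambda<\kappa$, then there exists a downward-closed $T\subseteq{}^{<\kappa}\kappa$ which is a prolific $\chi$-complete $\kappa$-Souslin tree admitting an injective $(\mathcal F^{\mathrm{fin}}_{\aleph_0},U)$-ascent path.
   Context: Downward-closed subsets of ${}^{<\kappa}\kappa$ are ordered by $\subsetneq$, height is $\mathrm{dom}$, $T_\alpha=T\cap{}^\alpha\kappa$. Prolific: $x^\frown\langle i\rangle\in T$ for all $x\in T_\alpha$, $i<\max\{\omega,\alpha\}$. $\chi$-complete: every increasing sequence of length $<\chi$ has an upper bound. $\kappa$-tree: height $\kappa$, levels of size $<\kappa$; $\kappa$-Souslin: no cofinal branch, no antichain of size $\kappa$. $E^\kappa_{\ge\chi}=\{\alpha<\kappa\mid\mathrm{cf}(\alpha)\ge\chi\}$. $\mathcal F^{\mathrm{fin}}_{\aleph_0}=\{Z\subseteq\omega\mid\omega\setminus Z$ finite$\}$. An $(\mathcal F,U)$-ascent path through $T$ is $\langle f_u\mid u\in U\rangle$ with $f_u:\bigcup\mathcal F\to T_{\mathrm{dom}(u)}$, $\{i\mid f_u(i)\subsetneq f_v(i)\}\in\mathcal F$ for $u\subsetneq v$ in $U$, and $\{i\mid f_u(i)\ne f_v(i)\}\in\mathcal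 F$ for distinct $u,v\in U$ of equal domain; injective if for every $b:\kappa\to\kappa$ with all $b\restriction\alpha\in U$ there are $\alpha<\kappa$, $I\in\mathcal F$ with $f_{b\restriction\alpha}\restriction I$ injective. $\mathrm{P}_{14}(\kappa,\sqsubseteq,1,\{S\})$: $\diamondsuit(\kappa)$ holds and there is $\langle C_\alpha\mid\alpha<\kappa\rangle$ with $C_\alpha$ club in $\alpha$ for limit $\alpha$, $C_{\bar\alpha}=C_\alpha\cap\bar\alpha$ whenever $\bar\alpha\in\mathrm{acc}(C_\alpha)=\{\gamma\in C_\alpha\mid\sup(C_\alpha\cap\gamma)=\gamma>0\}$, and for every cofinal $A\subseteq\kappa$ there are stationarily many $\alpha\in S$ with $\sup\{\beta\in C_\alpha\mid\mathrm{succ}_\omega(C_\alpha\setminus\beta)\subseteq A\}=\alpha$, where $\mathrm{succ}_\omega(D)=\{\delta\in D\mid0<\mathrm{otp}(D\cap\delta)<\omega\}$. *)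

(* Defs.v *)
(* Combinatorial set theory at a regular uncountable cardinal kappa,
   set up from scratch: kappa is modelled by a type K with a strict well-order lt
   (elements of K = ordinals < kappa). *)
From Stdlib Require Import Arith.

Section Defs.
Context {K : Type} (lt : K -> K -> Prop).

Definition le (a b : K) : Prop := lt a b \/ a = b.

(* |A| <= |B| for A : set X, B : set Y (all uses have Y inhabited) *)
Definition card_le {X Y : Type} (A : X -> Prop) (B : Y -> Prop) : Prop :=
  exists f : X -> Y, (forall x, A x -> B (f x)) /\
                     (forall x y, A x -> A y -> f x = f y -> x = y).

Definition finite_set {X : Type} (A : X -> Prop) : Prop :=
  exists n : nat, card_le A (fun m => m < n).

Definition fullK : K -> Prop := fun _ => True.

(* initial segment {b | b < a}, i.e. the ordinal a itself *)
Definition seg (a : K) : K -> Prop := fun b => lt b a.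

Definition strict_wellorder : Prop :=
  (forall a, ~ lt a a) /\
  (forall a b c, lt a b -> lt b c -> lt a c) /\
  (forall a b, lt a b \/ a = b \/ lt b a) /\
  well_founded lt.

Definition regular_uncountable : Prop :=
  strict_wellorder /\
  (forall a, ~ card_le fullK (seg a)) /\
  ~ card_le fullK (fun _ : nat => True) /\
  (forall A : K -> Prop,
      (forall a, exists b, A b /\ le a b) -> card_le fullK A).

Definition infinite_cardinal (chi : K) : Prop :=
  card_le (fun _ : nat => True) (seg chi) /\
  (forall b, lt b chi -> ~ card_le (seg chi) (seg b)).

Definition finite_ord (i : K) : Prop := finite_set (seg i).

Definition is_limit (a : K) : Prop :=
  (exists b, lt b a) /\ forall b, lt b a -> exists c, lt b c /\ lt c a.

Definition is_sup (A : K -> Prop) (g : K) : Prop :=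
  (forall c, A c -> le c g) /\ (forall d, (forall c, A c -> le c d) -> le g d).

(* A node x : alpha -> kappa is represented by its graph K -> option K whose
   domain is exactly the initial segment alpha. *)
Definition node := K -> option K.

Definition is_node (x : node) (a : K) : Prop :=
  forall b, lt b a <-> x b <> None.

Definition Node (x : node) : Prop := exists a, is_node x a.

Definition sub (x y : node) : Prop := forall c v, x c = Some v -> y c = Some v.
Definition strict_sub (x y : node) : Prop := sub x y /\ x <> y.

Definition restricts (x : node) (b : K -> K) (a : K) : Prop :=
  is_node x a /\ forall c, lt c a -> x c = Some (b c).

Definition concat_one (x : node) (a i : K) (y : node) : Prop :=
  forall c, (lt c a -> y c = x c) /\ (c = a -> y c = Some i) /\ (lt a c -> y c = None).

Definition downward_closed (T : node -> Prop) : Prop :=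
  (forall x, T x -> Node x) /\
  (forall x y, T y -> Node x -> strict_sub x y -> T x).

Definition level (T : node -> Prop) (a : K) : node -> Prop :=
  fun x => T x /\ is_node x a.

Definition kappa_tree (T : node -> Prop) : Prop :=
  downward_closed T /\
  (forall a, exists x, level T a x) /\
  (forall a, ~ card_le fullK (level T a)).

Definition prolific (T : node -> Prop) : Prop :=
  forall x a i, T x -> is_node x a -> (finite_ord i \/ lt i a) ->
    forall y, concat_one x a i y -> T y.

Definition chi_complete (chi : K) (T : node -> Prop) : Prop :=
  forall (th : K) (s : K -> node), lt th chi ->
    (forall d, lt d th -> T (s d)) ->
    (forall d d', lt d d' -> lt d' th -> strict_sub (s d) (s d')) ->
    exists t, T t /\ forall d, lt d th -> sub (s d) t.

Definition antichain (T A : node -> Prop) : Prop :=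
  (forall x, A x -> T x) /\
  forall x y, A x -> A y -> x <> y -> ~ strict_sub x y.

Definition has_cofinal_branch (T : node -> Prop) : Prop :=
  exists b : K -> K, forall a, exists x, T x /\ restricts x b a.

Definition souslin (T : node -> Prop) : Prop :=
  kappa_tree T /\ ~ has_cofinal_branch T /\
  forall A, antichain T A -> ~ card_le fullK A.

Definition small_power (lam chi : K) : Prop :=
  ~ card_le fullK (fun x : node => exists m, lt m chi /\ is_node x m /\
                                       forall c v, x c = Some v -> lt v lam).

Definition unbounded (A : K -> Prop) : Prop := forall a, exists b, A b /\ le a b.

Definition club (D : K -> Prop) : Prop :=
  unbounded D /\
  forall g, (exists b, lt b g) -> is_sup (fun c => D c /\ lt c g) g -> D g.

Definition stationary (X : K -> Prop) : Prop :=
  forall D, club D -> exists a, D a /\ X a.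

Definition club_in (a : K) (D : K -> Prop) : Prop :=
  (forall c, D c -> lt c a) /\
  (forall b, lt b a -> exists c, D c /\ le b c) /\
  (forall g, lt g a -> (exists b, lt b g) -> is_sup (fun c => D c /\ lt c g) g -> D g).

Definition acc (D : K -> Prop) (g : K) : Prop :=
  D g /\ is_sup (fun c => D c /\ lt c g) g /\ exists b, lt b g.

Definition E_ge (chi a : K) : Prop :=
  forall A : K -> Prop,
    ((forall c, A c -> lt c a) /\ (forall b, lt b a -> exists c, A c /\ le b c)) ->
    card_le (seg chi) A.

Definition succ_omega (D : K -> Prop) (d : K) : Prop :=
  D d /\ (exists c, D c /\ lt c d) /\ finite_set (fun c => D c /\ lt c d).

Definition diamond : Prop :=
  exists Aseq : K -> K -> Prop,
    (forall a b, Aseq a b -> lt b a) /\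
    forall X : K -> Prop,
      stationary (fun a => forall b, lt b a -> (X b <-> Aseq a b)).

Definition P14 (S : K -> Prop) : Prop :=
  diamond /\
  exists C : K -> K -> Prop,
    (forall a b, C a b -> lt b a) /\
    (forall a, is_limit a -> club_in a (C a)) /\
    (forall a g, acc (C a) g -> forall b, C g b <-> (C a b /\ lt b g)) /\
    (forall A : K -> Prop, unbounded A ->
       stationary (fun a => S a /\
         is_sup (fun be => C a be /\
                   forall d, succ_omega (fun c => C a c /\ le be c) d -> A d) a)).

Definition cofinite (P : nat -> Prop) : Prop := exists N, forall i, N <= i -> P i.

Definition ascent_path (T U : node -> Prop) (f : node -> nat -> node) : Prop :=
  (forall u a, U u -> is_node u a -> forall i, level T a (f u i)) /\
  (forall u v, U u -> U v -> strict_sub u v ->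
     cofinite (fun i => strict_sub (f u i) (f v i))) /\
  (forall u v a, U u -> U v -> is_node u a -> is_node v a -> u <> v ->
     cofinite (fun i => f u i <> f v i)).

Definition injective_ascent_path (T U : node -> Prop) (f : node -> nat -> node) : Prop :=
  ascent_path T U f /\
  forall b : K -> K, (forall a, exists x, U x /\ restricts x b a) ->
    exists a x, U x /\ restricts x b a /\
      exists N, forall i j, N <= i -> N <= j -> f x i = f x j -> i = j.

End Defs.

(* Main.v *)
(* The levels T_a, the ascent path F_a and a choice of extensions J_a are built by recursion on
   a. At limits of cofinality < chi all branches are kept. At limits of cofinality >= chi only
   two kinds of branches are kept: those that, from some point of C_a on, pass from each point
   of C_a to the next by J, and the values of F_a. Coherence of the C_a makes initial segments
   of the former branches at accumulation points of C_a again of this form.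

   The map J_e sends x to an extension of height e which, if possible, extends a node of the set
   guessed at e by diamond. If A is an antichain, then on an unbounded set G of heights the
   guess is the part of A below e and every x below e with an extension in A has one below e.
   Hence a node passing through e in G by a J-step has no proper extension in A unless it
   already extends an element of A, so P14 applied to G bounds the heights of the elements of A.

   The limit values of F_a need omega-blocks: if acc(C_a) is bounded in a, the i-th branch
   climbs the earlier path at finitely many points of C_a only and then uses J; if acc(C_a) is
   unbounded, it is the union of the earlier values along acc(C_a), and an omega-block of C_a
   contained in G seals the value at the supremum of the block. *)
From Stdlib Require Import Arith Lia List FinFun.
From Stdlib Require Import Classical ClassicalEpsilon FunctionalExtensionality PropExtensionality.
Require Import Defs.

(** * Choice, comparison of cardinalities, finite and cofinite sets *)

Lemma choice {X Y : Type} (R : X -> Y -> Prop) :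
  (forall x, exists y, R x y) -> exists f, forall x, R x (f x).
Proof.
  intros H.
  exists (fun x => proj1_sig (constructive_indefinite_description _ (H x))).
  intros x. exact (proj2_sig (constructive_indefinite_description _ (H x))).
Qed.

Lemma choice_on {X Y : Type} (y0 : Y) (A : X -> Prop) (R : X -> Y -> Prop) :
  (forall x, A x -> exists y, R x y) -> exists f, forall x, A x -> R x (f x).
Proof.
  intros H.
  destruct (choice (fun x y => A x -> R x y)) as [f Hf].
  - intros x. destruct (classic (A x)) as [a|a].
    + destruct (H x a) as [y Hy]. exists y. auto.
    + exists y0. tauto.
  - exists f. auto.
Qed.

Lemma card_le_trans {X Y Z : Type} (A : X -> Prop) (B : Y -> Prop) (D : Z -> Prop) :
  card_le A B -> card_le B D -> card_le A D.
Proof.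
  intros [f [Hf If]] [g [Hg Ig]]. exists (fun x => g (f x)). split; auto.
Qed.

Lemma card_le_incl {X : Type} (A B : X -> Prop) :
  (forall x, A x -> B x) -> card_le A B.
Proof. intros H. exists (fun x => x). auto. Qed.

Lemma finite_set_incl {X : Type} (A B : X -> Prop) :
  (forall x, A x -> B x) -> finite_set B -> finite_set A.
Proof. intros H [n Hn]. exists n. exact (card_le_trans _ _ _ (card_le_incl _ _ H) Hn). Qed.

Lemma finite_set_add {X : Type} (A : X -> Prop) (x0 : X) :
  finite_set A -> finite_set (fun x => A x \/ x = x0).
Proof.
  intros [n [f [Hf If]]]. exists (S n).
  exists (fun x => if excluded_middle_informative (x = x0) then n else f x).
  split.
  - intros x Hx. destruct (excluded_middle_informative (x = x0)); [lia|].
    destruct Hx as [Hx|Hx]; [|contradiction]. specialize (Hf x Hx). lia.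
  - intros x y Hx Hy.
    destruct (excluded_middle_informative (x = x0)) as [ex|nx];
    destruct (excluded_middle_informative (y = x0)) as [ey|ny]; intros E.
    + congruence.
    + destruct Hy as [Hy|Hy]; [|contradiction]. specialize (Hf y Hy). lia.
    + destruct Hx as [Hx|Hx]; [|contradiction]. specialize (Hf x Hx). lia.
    + apply If; tauto.
Qed.

Lemma finite_set_empty {X : Type} (A : X -> Prop) : (forall x, ~ A x) -> finite_set A.
Proof. intros H. exists 0, (fun _ => 0). split; [intros x Hx|intros x y Hx]; destruct (H x Hx). Qed.

Lemma nat_not_finite {X : Type} (A : X -> Prop) :
  finite_set A -> ~ card_le (fun _ : nat => True) A.
Proof.
  intros [n Hn] H. destruct (card_le_trans _ _ _ H Hn) as [f [Hf If]].
  assert (L : length (map f (seq 0 (S n))) <= length (seq 0 n)).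
  { apply NoDup_incl_length.
    - apply FinFun.Injective_map_NoDup; [|apply seq_NoDup].
      intros x y. apply If; exact I.
    - intros y Hy. apply in_map_iff in Hy. destruct Hy as [x [<- _]].
      apply in_seq. specialize (Hf x I). lia. }
  rewrite length_map, !length_seq in L. lia.
Qed.

Lemma cofinite_mono (P Q : nat -> Prop) :
  (forall i, P i -> Q i) -> cofinite P -> cofinite Q.
Proof. intros H [N HN]. exists N. auto. Qed.

Lemma cofinite_and (P Q : nat -> Prop) :
  cofinite P -> cofinite Q -> cofinite (fun i => P i /\ Q i).
Proof.
  intros [N HN] [M HM]. exists (N + M). intros i Hi. split; [apply HN|apply HM]; lia.
Qed.

Section Regular.
Context {K : Type} (lt : K -> K -> Prop).
Context (HR : regular_uncountable lt).

Local Notation "a ≺ b" := (lt a b) (at level 70).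
Local Notation "a ≼ b" := (le lt a b) (at level 70).
Local Notation node := (@node K).

(** * Well-ordered index set *)

Lemma lt_irrefl a : ~ a ≺ a.
Proof. apply HR. Qed.
Lemma lt_trans a b c : a ≺ b -> b ≺ c -> a ≺ c.
Proof. apply HR. Qed.
Lemma lt_total a b : a ≺ b \/ a = b \/ b ≺ a.
Proof. apply HR. Qed.
Lemma lt_wf : well_founded lt.
Proof. apply HR. Qed.
Lemma le_refl a : a ≼ a.
Proof. right; reflexivity. Qed.
Lemma lt_le_trans a b c : a ≺ b -> b ≼ c -> a ≺ c.
Proof. intros H [H'|<-]; [exact (lt_trans _ _ _ H H')|exact H]. Qed.
Lemma le_lt_trans a b c : a ≼ b -> b ≺ c -> a ≺ c.
Proof. intros [H| ->] H'; [exact (lt_trans _ _ _ H H')|exact H']. Qed.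
Lemma le_trans a b c : a ≼ b -> b ≼ c -> a ≼ c.
Proof. intros [H| ->] H'; [left; exact (lt_le_trans _ _ _ H H')|exact H']. Qed.
Lemma not_lt a b : ~ a ≺ b -> b ≼ a.
Proof. intros H. destruct (lt_total a b) as [|[->|]]; [contradiction|right; auto|left; auto]. Qed.
Lemma not_le a b : ~ a ≼ b -> b ≺ a.
Proof. intros H. destruct (lt_total a b) as [?|[->|]]; auto; destruct H; [left; auto|right; auto]. Qed.
Lemma le_antisym a b : a ≼ b -> b ≼ a -> a = b.
Proof.
  intros [H|H] H'; [|exact H].
  destruct (lt_irrefl a). exact (lt_le_trans _ _ _ H H').
Qed.

Ltac ord_sat :=
  repeat match goal with
  | H : ~ (lt _ _) |- _ => apply not_lt in H
  | H : ~ (le lt _ _) |- _ => apply not_le in H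
  end;
  repeat match goal with
  | H : lt ?a ?a |- _ => exfalso; exact (lt_irrefl a H)
  | H : lt ?a ?b, H' : le lt ?b ?a |- _ =>
      exfalso; exact (lt_irrefl a (lt_le_trans _ _ _ H H'))
  | H : lt ?a ?b, H' : lt ?b ?c |- _ =>
      lazymatch goal with _ : lt a c |- _ => fail | _ => pose proof (lt_trans _ _ _ H H') end
  | H : lt ?a ?b, H' : le lt ?b ?c |- _ =>
      lazymatch goal with _ : lt a c |- _ => fail | _ => pose proof (lt_le_trans _ _ _ H H') end
  | H : le lt ?a ?b, H' : lt ?b ?c |- _ =>
      lazymatch goal with _ : lt a c |- _ => fail | _ => pose proof (le_lt_trans _ _ _ H H') end
  | H : le lt ?a ?b, H' : le lt ?b ?c |- _ =>
      lazymatch goal with _ : lt a c |- _ => fail | _ : le lt a c |- _ => fail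
      | _ => lazymatch a with c => fail | _ => pose proof (le_trans _ _ _ H H') end end
  end.
Ltac ord :=
  subst;
  solve [match goal with
  | |- lt ?a ?b => apply NNPP; intro; ord_sat
  | |- le lt ?a ?b => apply NNPP; intro; ord_sat
  | |- ~ lt ?a ?b => intro; ord_sat
  | |- ~ le lt ?a ?b => intro; ord_sat
  | |- ?a <> ?b => intro; subst; ord_sat
  | |- @eq K ?a ?b => apply le_antisym; apply NNPP; intro; ord_sat
  | |- _ => exfalso; ord_sat
  end].

Lemma inhabited_index : inhabited K.
Proof.
  apply NNPP. intros N. apply HR. exists (fun _ => 0). split; [intros; exact I|].
  intros x. destruct N. exact (inhabits x).
Qed.

Lemma wf_min (P : K -> Prop) :
  (exists a, P a) -> exists a, P a /\ forall b, P b -> a ≼ b.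
Proof.
  intros [a Ha]. revert Ha. induction (lt_wf a) as [a _ IH]. intros Ha.
  destruct (classic (exists b, b ≺ a /\ P b)) as [[b [Hb Pb]]|N].
  - exact (IH b Hb Pb).
  - exists a. split; [exact Ha|]. intros b Pb. apply NNPP. intros C.
    apply N. exists b. split; [ord|exact Pb].
Qed.

(** * Sets of size less than $\kappa$ *)

Definition small {X : Type} (A : X -> Prop) : Prop := ~ card_le (@fullK K) A.

Lemma small_seg a : small (seg lt a).
Proof. apply HR. Qed.

Lemma small_bounded (A : K -> Prop) : small A -> exists b, forall a, A a -> a ≺ b.
Proof.
  intros H. apply NNPP. intros N. apply H. apply HR. intros a. apply NNPP. intros N'.
  apply N. exists a. intros b Hb. apply NNPP. intros C. apply N'.
  exists b. split; [exact Hb|ord].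
Qed.

Lemma small_card_le {X Y : Type} (A : X -> Prop) (B : Y -> Prop) :
  card_le A B -> small B -> small A.
Proof. intros H HB HA. exact (HB (card_le_trans _ _ _ HA H)). Qed.

Lemma small_incl {X : Type} (A B : X -> Prop) :
  (forall x, A x -> B x) -> small B -> small A.
Proof. intros H. apply small_card_le, card_le_incl, H. Qed.

Lemma small_image {X Y : Type} (A : X -> Prop) (f : X -> Y) :
  small A -> small (fun y => exists x, A x /\ y = f x).
Proof.
  intros H [g [Hg Ig]]. apply H.
  destruct (choice (fun k x => A x /\ g k = f x)) as [h Hh].
  - intros k. exact (Hg k I).
  - exists h. split; [intros k _; apply Hh|].
    intros k l _ _ E. apply Ig; try exact I.
    rewrite (proj2 (Hh k)), (proj2 (Hh l)), E. reflexivity.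
Qed.

Lemma small_fun_bounded {X : Type} (A : X -> Prop) (f : X -> K) :
  small A -> exists b, forall x, A x -> f x ≺ b.
Proof.
  intros H. destruct (small_bounded _ (small_image A f H)) as [b Hb].
  exists b. intros x Hx. apply Hb. exists x. auto.
Qed.

(** Given an injection [g] of [K] into the union, let [h k] be an index whose set contains [g k].
    Each fibre of [h] injects into one [B x], so it is bounded by some [q x], and these bounds lie
    below one [b]. Then [b] is below [q (h b)], which is below [b]. *)
Lemma small_union {X Y : Type} (A : X -> Prop) (B : X -> Y -> Prop) :
  small A -> (forall x, A x -> small (B x)) -> small (fun y => exists x, A x /\ B x y).
Proof.
  intros HA HB [g [Hg Ig]].
  destruct (choice (fun k x => A x /\ B x (g k))) as [h Hh].
  { intros k. exact (Hg k I). }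
  assert (Hfib : forall x, A x -> exists b, forall k, h k = x -> k ≺ b).
  { intros x Hx. apply (small_bounded (fun k => h k = x)). intros [p [Hp Ip]].
    apply (HB x Hx). exists (fun k => g (p k)). split.
    - intros k _. rewrite <- (Hp k I). apply Hh.
    - intros k l _ _ E. apply Ip; try exact I. exact (Ig _ _ I I E). }
  destruct inhabited_index as [k0].
  destruct (choice_on k0 A _ Hfib) as [q Hq].
  destruct (small_fun_bounded A q HA) as [b Hb].
  apply (lt_irrefl b).
  exact (lt_trans _ _ _ (Hq (h b) (proj1 (Hh b)) b eq_refl) (Hb _ (proj1 (Hh b)))).
Qed.

Lemma small_nat {X : Type} (A : X -> Prop) : card_le A (fun _ : nat => True) -> small A.
Proof. intros H. apply (small_card_le _ _ H). apply HR. Qed.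

Lemma small_subsingleton {X : Type} (A : X -> Prop) :
  (forall x y, A x -> A y -> x = y) -> small A.
Proof.
  intros H. apply small_nat. exists (fun _ => 0). split; [tauto|].
  intros x y Hx Hy _. exact (H x y Hx Hy).
Qed.

Lemma exists_gt a : exists b, a ≺ b.
Proof.
  apply NNPP. intros N.
  apply (small_subsingleton (fun b => b = a)); [congruence|]. apply HR.
  intros b. exists a. split; [reflexivity|]. apply not_lt. intros H. apply N. exists b. exact H.
Qed.

Definition is_succ (b a : K) : Prop := b ≺ a /\ forall c, b ≺ c -> a ≼ c.

Lemma succ_exists b : exists a, is_succ b a.
Proof.
  destruct (wf_min (fun a => b ≺ a) (exists_gt b)) as [a [Ha Hm]].
  exists a. split; assumption.
Qed.

Lemma zero_succ_limit a : (forall b, ~ b ≺ a) \/ (exists b, is_succ b a) \/ is_limit lt a.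
Proof.
  destruct (classic (exists b, b ≺ a)) as [E|E]; [|left; intros b Hb; apply E; exists b; exact Hb].
  right. destruct (classic (exists b, is_succ b a)) as [S|S]; [left; exact S|right].
  split; [exact E|]. intros b Hb. apply NNPP. intros N. apply S. exists b. split; [exact Hb|].
  intros c Hc. apply not_lt. intros H. apply N. exists c. auto.
Qed.

Lemma limit_not_succ a b : is_limit lt a -> ~ is_succ b a.
Proof.
  intros [_ H] [S1 S2]. destruct (H b S1) as [c [H1 H2]]. pose proof (S2 c H1). ord.
Qed.

Lemma least_upper_bound (A : K -> Prop) b :
  (forall a, A a -> a ≼ b) ->
  exists s, (forall a, A a -> a ≼ s) /\ (forall t, t ≺ s -> exists a, A a /\ t ≺ a).
Proof.
  intros H. destruct (wf_min (fun s => forall a, A a -> a ≼ s)) as [s [Hs Hm]].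
  { exists b. exact H. }
  exists s. split; [exact Hs|]. intros t Ht. apply NNPP. intros N.
  assert (s ≼ t).
  { apply Hm. intros a Ha. apply not_lt. intros C. apply N. exists a. auto. }
  ord.
Qed.

(* Enumerating [A] greedily along [I] either injects [I] into [A] or exhausts [A] before the end
   of [I]. *)
Lemma card_le_or_seg {X : Type} (I : K -> Prop) (A : X -> Prop) :
  (exists a, I a) -> ~ card_le I A -> exists th, I th /\ card_le A (seg lt th).
Proof.
  intros [a0 Ha0] HN.
  (* The chosen value is an element of [A] not listed before [a], and is unspecified once none is
     left. The type [option X] supplies the default that [epsilon] needs even for empty [X]. *)
  pose (step := fun (a : K) (rec : forall b, b ≺ a -> option X) =>
    epsilon (inhabits None) (fun o => exists x, o = Some x /\ A x /\
       forall b (h : b ≺ a), rec b h <> Some x)).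
  pose (e := fun a => Fix lt_wf (fun _ => option X) step a).
  assert (He : forall a, e a = step a (fun b _ => e b)).
  { intros a. unfold e. rewrite Fix_eq; [reflexivity|].
    intros x f g H. unfold step. f_equal. extensionality o.
    apply propositional_extensionality.
    split; intros [y [H1 [H2 H3]]]; exists y; (split; [|split]); auto; intros b h;
    [rewrite <- H|rewrite H]; auto. }
  destruct (classic (forall a, I a -> exists x, A x /\ forall b, b ≺ a -> e b <> Some x)) as [All|NAll].
  - exfalso. apply HN.
    assert (HS : forall a, I a -> exists x, e a = Some x /\ A x /\ forall b, b ≺ a -> e b <> Some x).
    { intros a Ha. rewrite He. unfold step.
      apply (epsilon_spec (inhabits None)
        (fun o => exists x, o = Some x /\ A x /\ forall b, b ≺ a -> e b <> Some x)).
      destruct (All a Ha) as [x Hx]. exists (Some x), x. auto. }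
    destruct (HS a0 Ha0) as [x0 _].
    destruct (choice_on x0 I _ HS) as [f Hf]. exists f. split.
    + intros x Hx. apply (Hf x Hx).
    + intros x y Hx Hy E. destruct (Hf x Hx) as [X1 [X2 X3]]. destruct (Hf y Hy) as [Y1 [Y2 Y3]].
      destruct (lt_total x y) as [L|[L|L]]; [|exact L|].
      * destruct (Y3 x L). congruence.
      * destruct (X3 y L). congruence.
  - apply not_all_ex_not in NAll. destruct NAll as [th Hth].
    apply imply_to_and in Hth. destruct Hth as [Ith Hth]. exists th. split; [exact Ith|].
    assert (HS : forall x, A x -> exists b, b ≺ th /\ e b = Some x).
    { intros x Hx. apply NNPP. intros N. apply Hth. exists x. split; [exact Hx|].
      intros b Hb E. apply N. exists b. auto. }
    destruct (choice_on a0 A _ HS) as [f Hf]. exists f. split.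
    + intros x Hx. apply (Hf x Hx).
    + intros x y Hx Hy E. destruct (Hf x Hx) as [_ EX]. destruct (Hf y Hy) as [_ EY].
      rewrite E in EX. congruence.
Qed.

Lemma small_card_le_seg {X : Type} (A : X -> Prop) : small A -> exists th, card_le A (seg lt th).
Proof.
  intros H. destruct inhabited_index as [k0].
  destruct (card_le_or_seg (@fullK K) A (ex_intro _ k0 I) H) as [th [_ Hth]].
  exists th. exact Hth.
Qed.

Lemma card_le_full_above b : card_le (@fullK K) (fun c => b ≺ c).
Proof.
  apply HR. intros a. destruct (lt_total a b) as [L|[L|L]].
  - destruct (exists_gt b) as [c Hc]. exists c. split; [exact Hc|left; ord].
  - destruct (exists_gt b) as [c Hc]. exists c. split; [exact Hc|left; ord].
  - exists a. split; [exact L|apply le_refl].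
Qed.

(** By recursion on the rank [m], an injection of the elements of rank [m] is chosen that avoids all
    values used at lower ranks. Those values form a small set, hence are bounded, and a tail of [K]
    still has size $\kappa$. *)
Lemma card_le_full_of_rank {X : Type} (A : X -> Prop) (r : X -> K) :
  (forall m, small (fun x => A x /\ r x = m)) -> card_le A (@fullK K).
Proof.
  intros HS. destruct inhabited_index as [k0].
  pose (step := fun (m : K) (rec : forall b, b ≺ m -> X -> K) =>
    epsilon (inhabits (fun _ : X => k0)) (fun q =>
       (forall x y, A x -> A y -> r x = m -> r y = m -> q x = q y -> x = y) /\
       (forall b (h : b ≺ m) x y, A x -> r x = m -> A y -> r y = b -> q x <> rec b h y))).
  pose (e := fun m => Fix lt_wf (fun _ => X -> K) step m).
  assert (He : forall a, e a = step a (fun b _ => e b)).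
  { intros a. unfold e. rewrite Fix_eq; [reflexivity|].
    intros x f g H. unfold step. f_equal. extensionality o.
    apply propositional_extensionality.
    split; intros [H1 H2]; split; auto; intros b h; [rewrite <- H|rewrite H]; auto. }
  assert (Hspec : forall m,
     (forall x y, A x -> A y -> r x = m -> r y = m -> e m x = e m y -> x = y) /\
     (forall b (h : b ≺ m) x y, A x -> r x = m -> A y -> r y = b -> e m x <> e b y)).
  { intros m. rewrite (He m). unfold step. apply (epsilon_spec _
     (fun q => (forall x y, A x -> A y -> r x = m -> r y = m -> q x = q y -> x = y) /\
       (forall b (h : b ≺ m) x y, A x -> r x = m -> A y -> r y = b -> q x <> e b y))).
    assert (HU : small (fun c => exists b, b ≺ m /\ exists x, (A x /\ r x = b) /\ c = e b x)).
    { apply (small_union (seg lt m)); [apply small_seg|].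
      intros b _. apply small_image, HS. }
    destruct (small_bounded _ HU) as [bd Hbd].
    destruct (small_card_le_seg _ (HS m)) as [th [f [Hf If]]].
    destruct (card_le_full_above bd) as [g [Hg Ig]].
    exists (fun x => g (f x)). split.
    - intros x y Hx Hy Rx Ry E. apply If; auto. apply Ig; try exact I. exact E.
    - intros b Hb x y Hx Rx Hy Ry E.
      assert (H1 : e b y ≺ bd). { apply Hbd. exists b. split; [exact Hb|]. exists y. auto. }
      pose proof (Hg (f x) I). rewrite <- E in H1. ord. }
  exists (fun x => e (r x) x). split; [intros; exact I|].
  intros x y Hx Hy E. destruct (lt_total (r x) (r y)) as [L|[L|L]].
  - symmetry in E. destruct (proj2 (Hspec (r y)) _ L y x Hy eq_refl Hx eq_refl E).
  - rewrite <- L in E. symmetry in L. exact (proj1 (Hspec (r x)) x y Hx Hy eq_refl L E).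
  - destruct (proj2 (Hspec (r x)) _ L x y Hx eq_refl Hy eq_refl E).
Qed.

(** Rank a pair by its larger coordinate: fewer than $\kappa$ pairs share a rank. *)
Lemma pairing_exists : exists p : K -> K -> K, forall a b c d, p a b = p c d -> a = c /\ b = d.
Proof.
  pose (r := fun x : K * K => if excluded_middle_informative (fst x ≺ snd x) then snd x else fst x).
  destruct (card_le_full_of_rank (fun _ : K * K => True) r) as [q [_ Iq]].
  - intros m. destruct (succ_exists m) as [m' [Hm' _]].
    apply (small_incl _ (fun x : K * K => exists a, a ≺ m' /\ exists b, b ≺ m' /\ x = (a, b))).
    + intros [a b] [_ E]. unfold r in E. simpl in E.
      destruct (excluded_middle_informative (a ≺ b)) as [L|L].
      * exists a. split; [ord|]. exists b. split; [ord|reflexivity].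
      * exists a. split; [ord|]. exists b. split; [ord|reflexivity].
    + apply (small_union (seg lt m')); [apply small_seg|].
      intros a _. apply small_image, small_seg.
  - exists (fun a b => q (a, b)). intros a b c d E. apply Iq in E; try exact I.
    injection E. auto.
Qed.

Lemma seg_le_small a : small (fun b => b ≼ a).
Proof.
  destruct (exists_gt a) as [a' Ha]. apply (small_incl _ (seg lt a')); [|apply small_seg].
  intros b Hb. unfold seg. ord.
Qed.

Lemma exists_upper2 a b : exists c, a ≺ c /\ b ≺ c.
Proof.
  destruct (lt_total a b) as [L|[->|L]].
  - destruct (exists_gt b) as [c Hc]. exists c. split; ord.
  - destruct (exists_gt b) as [c Hc]. exists c. auto.
  - destruct (exists_gt a) as [c Hc]. exists c. split; ord.
Qed.

(** Closure points arise as suprema of $\omega$-sequences in which each term bounds the values of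
    [h] up to the previous term; such suprema exist since countable sets are bounded. The parameter
    [a0] pushes the club above a given point. *)
Lemma club_closed_under (h : K -> K) (a0 : K) :
  club lt (fun g => a0 ≼ g /\ forall b, b ≺ g -> h b ≺ g).
Proof.
  split.
  - intros a.
    assert (HB : forall s, exists t, s ≺ t /\ forall b, b ≼ s -> h b ≺ t).
    { intros s. destruct (small_fun_bounded _ h (seg_le_small s)) as [t Ht].
      destruct (exists_upper2 s t) as [t' [H1 H2]]. exists t'. split; [exact H1|].
      intros b Hb. specialize (Ht b Hb). ord. }
    destruct (choice _ HB) as [nx Hnx].
    destruct (exists_upper2 a a0) as [s0 [Ha Ha0]].
    pose (s := fun n => Nat.iter n nx s0).
    assert (HS : forall n, s n ≺ s (S n)). { intros n. apply Hnx. }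
    destruct (small_fun_bounded (fun _ : nat => True) s) as [t Ht].
    { apply small_nat. exists (fun n => n). auto. }
    destruct (least_upper_bound (fun c => exists n, c = s n) t) as [g [Hg1 Hg2]].
    { intros c [n ->]. left. apply Ht. exact I. }
    assert (H0 : s0 ≼ g). { apply Hg1. exists 0. reflexivity. }
    exists g. split; [split|]; try ord.
    intros b Hb. destruct (Hg2 b Hb) as [c [[n ->] Hc]].
    assert (h b ≺ s (S n)). { apply Hnx. fold (s n). left. exact Hc. }
    assert (s (S n) ≼ g). { apply Hg1. exists (S n). reflexivity. }
    ord.
  - intros g [b0 Hb0] [Hs1 Hs2].
    assert (HC : forall b, b ≺ g -> exists c, (a0 ≼ c /\ forall b, b ≺ c -> h b ≺ c) /\ c ≺ g /\ b ≺ c).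
    { intros b Hb. apply NNPP. intros N. assert (g ≼ b); [|ord].
      apply Hs2. intros c [Hc1 Hc2]. apply not_lt. intros L. apply N. exists c. auto. }
    split.
    + destruct (HC b0 Hb0) as [c [[H1 _] [H2 _]]]. left. ord.
    + intros b Hb. destruct (HC b Hb) as [c [[H1 H2] [H3 H4]]]. specialize (H2 b H4). ord.
Qed.

(** * Nodes and their restrictions *)

Definition restr (x : node) (b : K) : node :=
  fun c => if excluded_middle_informative (c ≺ b) then x c else None.

Lemma restr_lt x b c : c ≺ b -> restr x b c = x c.
Proof. intros H. unfold restr. destruct (excluded_middle_informative (c ≺ b)); tauto. Qed.

Lemma restr_ge x b c : ~ c ≺ b -> restr x b c = None.
Proof. intros H. unfold restr. destruct (excluded_middle_informative (c ≺ b)); tauto. Qed.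

Lemma node_None x a c : is_node lt x a -> ~ c ≺ a -> x c = None.
Proof.
  intros Hx Hc. destruct (x c) eqn:E; [|reflexivity].
  destruct Hc. apply Hx. congruence.
Qed.

Lemma node_Some x a c : is_node lt x a -> c ≺ a -> exists v, x c = Some v.
Proof. intros Hx Hc. apply Hx in Hc. destruct (x c) as [v|]; [exists v; auto|congruence]. Qed.

Lemma node_level_unique x a b : is_node lt x a -> is_node lt x b -> a = b.
Proof.
  intros Ha Hb.
  destruct (lt_total a b) as [L|[L|L]]; [|exact L|]; exfalso.
  - apply (lt_irrefl a). apply Ha. apply Hb. exact L.
  - apply (lt_irrefl b). apply Hb. apply Ha. exact L.
Qed.

Lemma restr_node x a b : is_node lt x a -> b ≼ a -> is_node lt (restr x b) b.
Proof.
  intros Hx Hb c. split; intros H.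
  - rewrite restr_lt by exact H. apply Hx. ord.
  - destruct (classic (c ≺ b)) as [L|L]; [exact L|]. rewrite restr_ge in H by exact L. congruence.
Qed.

Lemma restr_restr x b c : b ≼ c -> restr (restr x c) b = restr x b.
Proof.
  intros H. extensionality d. destruct (classic (d ≺ b)) as [L|L].
  - rewrite !restr_lt; auto. ord.
  - rewrite !restr_ge; auto.
Qed.

Lemma restr_id x a : is_node lt x a -> restr x a = x.
Proof.
  intros H. extensionality d. destruct (classic (d ≺ a)) as [L|L].
  - apply restr_lt; auto.
  - rewrite restr_ge; auto. symmetry. exact (node_None _ _ _ H L).
Qed.

Lemma sub_restr x b : sub (restr x b) x.
Proof.
  intros c v H. destruct (classic (c ≺ b)) as [L|L].
  - rewrite restr_lt in H; auto.
  - rewrite restr_ge in H; auto. congruence.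
Qed.

Lemma sub_eq_restr x y a : is_node lt x a -> sub x y -> restr y a = x.
Proof.
  intros Hx H. extensionality c. destruct (classic (c ≺ a)) as [L|L].
  - rewrite restr_lt; auto. destruct (node_Some _ _ _ Hx L) as [v Hv].
    rewrite Hv. apply H. exact Hv.
  - rewrite restr_ge; auto. symmetry. exact (node_None _ _ _ Hx L).
Qed.

Lemma restr_eq_sub x y b : restr y b = x -> sub x y.
Proof. intros <-. apply sub_restr. Qed.

Lemma sub_level x y a b : is_node lt x a -> is_node lt y b -> sub x y -> a ≼ b.
Proof.
  intros Hx Hy H. apply not_lt. intros L. destruct (node_Some _ _ _ Hx L) as [v Hv].
  apply (lt_irrefl b). apply Hy. rewrite (H _ _ Hv). congruence.
Qed.

Lemma node_ext x y a :
  is_node lt x a -> is_node lt y a -> (forall c, c ≺ a -> x c = y c) -> x = y.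
Proof.
  intros Hx Hy H. extensionality c. destruct (classic (c ≺ a)) as [L|L]; [auto|].
  rewrite (node_None _ _ _ Hx L), (node_None _ _ _ Hy L). reflexivity.
Qed.

Definition cofinal_in (D : K -> Prop) (g : K) : Prop :=
  forall b, b ≺ g -> exists c, D c /\ b ≺ c /\ c ≺ g.

(** The value at [b] is read off from [s] at a point [p b] of [D] above [b]; coherence makes the
    choice of that point irrelevant. *)
Lemma node_union (D : K -> Prop) (g : K) (s : K -> node) :
  cofinal_in D g ->
  (forall d, D d -> is_node lt (s d) d) ->
  (forall d e, D d -> D e -> d ≺ e -> restr (s e) d = s d) ->
  exists y, is_node lt y g /\ forall d, D d -> d ≺ g -> restr y d = s d.
Proof.
  intros HD Hn Hs. destruct inhabited_index as [k0].
  destruct (choice_on k0 (fun b => b ≺ g) _ HD) as [p Hp].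
  pose (y := fun b => if excluded_middle_informative (b ≺ g) then s (p b) b else None).
  assert (Hy : forall d, D d -> d ≺ g -> forall b, b ≺ d -> y b = s d b).
  { intros d Dd Ld b Lb. unfold y.
    destruct (excluded_middle_informative (b ≺ g)) as [L|L]; [|destruct L; ord].
    destruct (Hp b L) as [P1 [P2 P3]].
    destruct (lt_total d (p b)) as [C|[<-|C]]; [|reflexivity|].
    - rewrite <- (Hs d (p b) Dd P1 C). rewrite restr_lt; auto.
    - rewrite <- (Hs (p b) d P1 Dd C). rewrite restr_lt; auto. }
  assert (Ny : is_node lt y g).
  { intros b. unfold y. destruct (excluded_middle_informative (b ≺ g)) as [L|L].
    - split; [|auto]. intros _. destruct (Hp b L) as [P1 [P2 P3]]. apply (Hn _ P1). exact P2.
    - split; [tauto|]. intros H. congruence. }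
  exists y. split; [exact Ny|]. intros d Dd Ld.
  apply (node_ext _ _ d).
  - apply (restr_node _ g); [exact Ny|left; exact Ld].
  - exact (Hn d Dd).
  - intros c Lc. rewrite restr_lt by exact Lc. apply Hy; auto.
Qed.

Definition extend (x : node) (b v : K) : node :=
  fun c => if excluded_middle_informative (c = b) then Some v else x c.

Lemma extend_at x b v : extend x b v b = Some v.
Proof. unfold extend. destruct (excluded_middle_informative (b = b)); congruence. Qed.

Lemma extend_node x b v a : is_node lt x b -> is_succ b a -> is_node lt (extend x b v) a.
Proof.
  intros Hx [S1 S2] c. unfold extend. destruct (excluded_middle_informative (c = b)) as [->|N].
  - split; [congruence|auto].
  - split; intros H.
    + apply Hx. destruct (lt_total c b) as [L|[L|L]]; [exact L|contradiction|].
      specialize (S2 c L). ord.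
    + apply Hx in H. ord.
Qed.

Lemma restr_extend x b v c : c ≼ b -> restr (extend x b v) c = restr x c.
Proof.
  intros Hc. extensionality d. destruct (classic (d ≺ c)) as [L|L].
  - rewrite !restr_lt by exact L. unfold extend.
    destruct (excluded_middle_informative (d = b)); [|reflexivity]. ord.
  - rewrite !restr_ge by exact L. reflexivity.
Qed.

(* [diamond] enumerates all bounded subsets of [K]; a node is coded by its graph, a bounded
   subset via a pairing function. *)
Lemma node_code : diamond lt ->
  exists pi : node -> K, forall x y, Node lt x -> Node lt y -> pi x = pi y -> x = y.
Proof.
  intros [As [HA Hd]]. destruct pairing_exists as [p Hp]. destruct inhabited_index as [k0].
  pose (B := fun (x : node) b => exists c v, x c = Some v /\ b = p c v).
  assert (HB : forall x, Node lt x -> exists g, forall b, B x b <-> As g b).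
  { intros x [a Ha].
    destruct (small_fun_bounded (seg lt a) (fun c => match x c with Some v => p c v | None => k0 end)
                (small_seg a)) as [bd Hbd].
    assert (HB : forall b, B x b -> b ≺ bd).
    { intros b [c [v [E ->]]]. assert (L : c ≺ a). { apply Ha. congruence. }
      specialize (Hbd c L). rewrite E in Hbd. exact Hbd. }
    (* The club serves only to place [g] above [bd], so that the guess at [g] is the whole of [B x]
       and not just an initial part. *)
    destruct (Hd (B x) _ (club_closed_under (fun _ => bd) bd)) as [g [[G1 _] G2]].
    exists g. intros b. split; intros H.
    - apply G2; [|exact H]. specialize (HB b H). ord.
    - apply G2; [|exact H]. exact (HA g b H). }
  destruct (choice_on k0 _ _ HB) as [pi Hpi]. exists pi. intros x y Hx Hy E.
  assert (S : forall x y, Node lt x -> Node lt y -> pi x = pi y -> sub x y).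
  { clear x y Hx Hy E. intros x y Hx Hy E c v H.
    assert (B y (p c v)) as [c' [v' [H1 H2]]].
    { apply (Hpi y Hy). rewrite <- E. apply (Hpi x Hx). exists c, v. auto. }
    apply Hp in H2. destruct H2 as [-> ->]. exact H1. }
  destruct Hx as [a Ha]. destruct Hy as [b Hb].
  assert (a = b) as <-.
  { apply le_antisym; eapply sub_level; eauto; apply S; auto; eexists; eauto. }
  rewrite <- (restr_id y a Hb). symmetry. apply (sub_eq_restr _ _ _ Ha).
  apply S; auto; eexists; eauto.
Qed.

Lemma finite_ord_lt_infinite chi i : infinite_cardinal lt chi -> finite_ord lt i -> i ≺ chi.
Proof.
  intros [H _] Hi. apply NNPP. intros N. apply (nat_not_finite _ Hi).
  apply (card_le_trans _ _ _ H). apply card_le_incl. unfold seg. intros x Hx. ord.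
Qed.

(* [c b u i] is the value appended at height [b] along the [i]-th branch of the ascent path
   below [u]; [mu b] bounds the values allowed at height [b]. *)
Lemma labels_exist (chi : K) (U : node -> Prop) :
  kappa_tree lt U ->
  exists (mu : K -> K) (c : K -> node -> nat -> K), forall b,
    chi ≼ mu b /\ b ≼ mu b /\
    forall a, is_succ b a ->
      (forall u i, U u -> is_node lt u a -> c b u i ≺ mu b) /\
      (forall u i v j, U u -> is_node lt u a -> U v -> is_node lt v a ->
          c b u i = c b v j -> u = v /\ i = j).
Proof.
  intros [_ [_ HU]].
  assert (H : forall b, exists mc : K * (node -> nat -> K),
    chi ≼ fst mc /\ b ≼ fst mc /\
    forall a, is_succ b a ->
      (forall u i, U u -> is_node lt u a -> snd mc u i ≺ fst mc) /\
      (forall u i v j, U u -> is_node lt u a -> U v -> is_node lt v a ->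
          snd mc u i = snd mc v j -> u = v /\ i = j)).
  { intros b. destruct (succ_exists b) as [a Ha].
    assert (SU : small (fun p : node * nat => exists u, level lt U a u /\ exists i, True /\ p = (u, i))).
    { apply small_union; [exact (HU a)|]. intros u _. apply small_image.
      apply small_nat. exists (fun n => n). auto. }
    destruct (small_card_le_seg _ SU) as [th [f [Hf If]]].
    destruct (exists_upper2 chi b) as [m1 [M1 M2]].
    destruct (exists_upper2 m1 th) as [m [M3 M4]].
    exists (m, fun u i => f (u, i)). simpl.
    split; [left; ord|]. split; [left; ord|].
    intros a' Ha'. assert (a' = a) as ->.
    { destruct Ha as [A1 A2], Ha' as [A3 A4]. apply le_antisym; auto. }
    split.
    - intros u i Uu Nu. assert (f (u, i) ≺ th). { apply Hf. exists u. split; [split; auto|]. exists i. auto. }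
      ord.
    - intros u i v j Uu Nu Uv Nv E. apply If in E.
      + injection E. auto.
      + exists u. split; [split; auto|]. exists i. auto.
      + exists v. split; [split; auto|]. exists j. auto. }
  destruct (choice _ H) as [mc Hmc].
  exists (fun b => fst (mc b)), (fun b => snd (mc b)). exact Hmc.
Qed.

(** * Coherent clubs *)

Context (C : K -> K -> Prop).
Context (C_lt : forall a b, C a b -> b ≺ a).
Context (C_club : forall a, is_limit lt a -> club_in lt a (C a)).
Context (C_coherent : forall a g, acc lt (C a) g -> forall b, C g b <-> (C a b /\ b ≺ g)).

Lemma acc_iff (D : K -> Prop) g : acc lt D g <-> D g /\ (exists b, b ≺ g) /\ cofinal_in D g.
Proof.
  split.
  - intros [H1 [[H2 H3] H4]]. split; [exact H1|]. split; [exact H4|].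
    intros b Hb. apply NNPP. intros N. assert (g ≼ b); [|ord].
    apply H3. intros c [Dc Lc]. apply not_lt. intros L. apply N. exists c. auto.
  - intros [H1 [H2 H3]]. split; [exact H1|]. split; [|exact H2]. split.
    + intros c [_ L]. left. exact L.
    + intros d Hd. apply not_lt. intros L. destruct (H3 d L) as [c [Dc [L1 L2]]].
      specialize (Hd c (conj Dc L2)). ord.
Qed.

Lemma limit_of_cofinal (D : K -> Prop) g : (exists b, b ≺ g) -> cofinal_in D g -> is_limit lt g.
Proof.
  intros H1 H2. split; [exact H1|]. intros b Hb. destruct (H2 b Hb) as [c [_ [L1 L2]]].
  exists c. auto.
Qed.

Lemma C_cofinal a : is_limit lt a -> cofinal_in (C a) a.
Proof.
  intros Ha b Hb. destruct (proj2 Ha b Hb) as [b' [L1 L2]].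
  destruct (C_club a Ha) as [_ [H _]]. destruct (H b' L2) as [c [Hc Lc]].
  exists c. split; [exact Hc|]. split; [ord|]. apply C_lt. exact Hc.
Qed.

Lemma C_closed a g : is_limit lt a -> g ≺ a -> (exists b, b ≺ g) -> cofinal_in (C a) g -> C a g.
Proof.
  intros Ha Lg Hg H. destruct (C_club a Ha) as [_ [_ HC]]. apply HC; auto. split.
  - intros c [_ L]. left. exact L.
  - intros d Hd. apply not_lt. intros L. destruct (H d L) as [c [Dc [L1 L2]]].
    specialize (Hd c (conj Dc L2)). ord.
Qed.

Lemma acc_limit D g : acc lt D g -> is_limit lt g.
Proof. intros H. apply acc_iff in H. apply (limit_of_cofinal D); tauto. Qed.

Lemma acc_trans a g d : acc lt (C a) g -> acc lt (C a) d -> d ≺ g -> acc lt (C g) d.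
Proof.
  intros Hg Hd L. pose proof (C_coherent a g Hg) as HC.
  apply acc_iff in Hd. destruct Hd as [D1 [D2 D3]]. apply acc_iff.
  split; [apply HC; auto|]. split; [exact D2|].
  intros b Hb. destruct (D3 b Hb) as [c [Hc [L1 L2]]]. exists c.
  split; [apply HC; split; [exact Hc|ord]|]. auto.
Qed.

Lemma acc_C_acc a g d : acc lt (C a) g -> acc lt (C g) d -> acc lt (C a) d.
Proof.
  intros Hg Hd. pose proof (C_coherent a g Hg) as HC.
  apply acc_iff in Hd. destruct Hd as [D1 [D2 D3]]. apply acc_iff.
  split; [apply HC; auto|]. split; [exact D2|].
  intros b Hb. destruct (D3 b Hb) as [c [Hc L]]. exists c. split; [apply HC; exact Hc|exact L].
Qed.

Definition consec (D : K -> Prop) (d e : K) : Prop :=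
  D d /\ D e /\ d ≺ e /\ forall c, D c -> d ≺ c -> e ≼ c.

Lemma consec_coherent a g d e : acc lt (C a) g -> consec (C g) d e -> consec (C a) d e.
Proof.
  intros Hg [H1 [H2 [H3 H4]]]. pose proof (C_coherent a g Hg) as HC.
  apply HC in H1. destruct H1 as [H1 L1]. apply HC in H2. destruct H2 as [H2 L2].
  repeat split; auto. intros c Hc L.
  destruct (classic (c ≺ g)) as [L'|L']; [|left; ord].
  apply H4; auto. apply HC. auto.
Qed.

Lemma consec_next a d : is_limit lt a -> C a d -> exists e, consec (C a) d e.
Proof.
  intros Ha Hd. destruct (wf_min (fun e => C a e /\ d ≺ e)) as [e [[He L] Hm]].
  - destruct (C_cofinal a Ha d (C_lt _ _ Hd)) as [e [He [L _]]]. exists e. auto.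
  - exists e. repeat split; auto.
Qed.

(** The supremum [s] of [C a] below [e] lies in [C a] by closedness. It is the predecessor sought,
    unless it equals [e], which would make [e] an accumulation point. *)
Lemma consec_pred a b e : is_limit lt a -> C a e -> C a b -> b ≺ e -> ~ acc lt (C a) e ->
  exists d, consec (C a) d e /\ b ≼ d.
Proof.
  intros Ha He Hb Lb NA.
  destruct (least_upper_bound (fun c => C a c /\ c ≺ e) e) as [s [S1 S2]].
  { intros c [_ L]. left. exact L. }
  assert (Lb' : b ≼ s). { apply S1. auto. }
  assert (Lse : s ≼ e).
  { apply not_lt. intros L. destruct (S2 e L) as [c [[_ L1] L2]]. ord. }
  assert (Cs : C a s).
  { destruct Lse as [Lse| ->]; [|exact He].
    apply NNPP. intros N. apply N. apply C_closed; auto.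
    - pose proof (C_lt _ _ He). ord.
    - exists b. destruct Lb' as [L| ->]; [exact L|contradiction].
    - intros t Lt. destruct (S2 t Lt) as [c [[Hc L1] L2]]. exists c.
      split; [exact Hc|]. split; [exact L2|].
      destruct (S1 c (conj Hc L1)) as [L| ->]; [exact L|contradiction]. }
  destruct Lse as [Lse| ->].
  - exists s. split; [|exact Lb']. repeat split; auto.
    intros c Hc L. apply not_lt. intros L'. pose proof (S1 c (conj Hc L')). ord.
  - exfalso. apply NA. apply acc_iff. split; [exact He|]. split; [exists b; exact Lb|].
    intros t Lt. destruct (S2 t Lt) as [c [[Hc L1] L2]]. exists c. auto.
Qed.

(** Induction on [e], removing the predecessor each time. This shows that points of [C a] before the
    next accumulation point above [b] belong to the $\omega$-block starting at [b]. *)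
Lemma finite_between a b e : is_limit lt a -> C a b -> C a e -> b ≼ e ->
  (forall d, acc lt (C a) d -> b ≺ d -> e ≺ d) ->
  finite_set (fun c => (C a c /\ b ≼ c) /\ c ≺ e).
Proof.
  intros Ha Hb. induction (lt_wf e) as [e _ IH]. intros He L HN.
  destruct L as [L| ->].
  - destruct (consec_pred a b e) as [d [Hd Ld]]; auto.
    { intros A. apply (lt_irrefl e). apply HN; auto. }
    destruct Hd as [D1 [D2 [D3 D4]]].
    apply (finite_set_incl _ (fun c => ((C a c /\ b ≼ c) /\ c ≺ d) \/ c = d)).
    + intros c [[H1 H2] H3]. destruct (lt_total c d) as [Q|[Q|Q]]; auto.
      specialize (D4 c H1 Q). ord.
    + apply finite_set_add, IH; auto. intros f A Lf. specialize (HN f A Lf). ord.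
  - apply finite_set_empty. intros c [[_ H1] H2]. ord.
Qed.

(** * The recursion *)

Context (chi : K) (U : node -> Prop) (As : K -> K -> Prop) (pi : node -> K).
Context (mu : K -> K) (lab : K -> node -> nat -> K).

(** The data built at one height [a]: the level $T_a$, the path values $F_a(u)(i)$ and the extension
    map $J_a$. *)
Record stage := Stage { lv : node -> Prop; asc : node -> nat -> node; jump : node -> node }.

Definition follows (D : K -> Prop) (j : K -> node -> node) (b : K) (y : node) : Prop :=
  forall d e, consec D d e -> b ≼ d -> restr y e = j e (restr y d).

Definition branch (a : K) (P : K -> stage) (y : node) : Prop :=
  is_node lt y a /\ forall b, b ≺ a -> lv (P b) (restr y b).

Definition follower (a : K) (P : K -> stage) (y : node) : Prop :=
  exists b, C a b /\ follows (C a) (fun e => jump (P e)) b y.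

(* At limits, the path agrees with the earlier one for all indices (not only almost all) along
   [acc (C a)]: this is what makes unions over [acc (C a)] available at later limits. *)
Definition asc_spec (a : K) (P : K -> stage) (u : node) (g : nat -> node) : Prop :=
  (forall i, branch a P (g i)) /\
  (forall d, d ≺ a -> cofinite (fun i => restr (g i) d = asc (P d) (restr u d) i)) /\
  (forall b, is_succ b a -> forall i, g i b = Some (lab b u i)) /\
  (is_limit lt a ->
     (forall d, acc lt (C a) d -> forall i, restr (g i) d = asc (P d) (restr u d) i) /\
     ((exists b, b ≺ a /\ forall d, acc lt (C a) d -> d ≼ b) -> forall i, follower a P (g i))).

Definition next_asc (a : K) (P : K -> stage) (u : node) : nat -> node :=
  epsilon (inhabits (fun _ _ => None)) (asc_spec a P u).

(** At a successor of [b], any value below [mu b] may be appended; [mu b] is later taken large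
    enough for prolificness and for the labels of the path. The last clause thins out only limits of
    cofinality at least [chi]. *)
Definition next_lv (a : K) (P : K -> stage) (y : node) : Prop :=
  branch a P y /\
  (forall b v, is_succ b a -> y b = Some v -> v ≺ mu b) /\
  (is_limit lt a -> E_ge lt chi a ->
     follower a P y \/ exists u i, U u /\ is_node lt u a /\ y = next_asc a P u i).

Definition hit (a : K) (y : node) : Prop := exists b, b ≺ a /\ As a (pi (restr y b)).

(** Hitting the guess is stated as an implication, a preference rather than a demand, so that a
    choice exists as soon as [x] has any extension at height [a]. *)
Definition next_jump (a : K) (P : K -> stage) (x : node) : node :=
  epsilon (inhabits (fun _ => None)) (fun y =>
    (next_lv a P y /\ sub x y) /\ ((exists z, (next_lv a P z /\ sub x z) /\ hit a z) -> hit a y)).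

Definition next (a : K) (P : K -> stage) : stage :=
  Stage (next_lv a P) (next_asc a P) (next_jump a P).

Lemma branch_ext a P Q y : (forall b, b ≺ a -> P b = Q b) -> branch a P y -> branch a Q y.
Proof. intros E [H1 H2]. split; [exact H1|]. intros b Hb. rewrite <- E; auto. Qed.

Lemma follower_ext a P Q y : (forall b, b ≺ a -> P b = Q b) -> follower a P y -> follower a Q y.
Proof.
  intros E [b [Hb H]]. exists b. split; [exact Hb|]. intros d e Hde L.
  rewrite (H d e Hde L), E; [reflexivity|]. apply C_lt. apply Hde.
Qed.

Lemma asc_spec_ext a P Q u g :
  (forall b, b ≺ a -> P b = Q b) -> asc_spec a P u g -> asc_spec a Q u g.
Proof.
  intros E [H1 [H2 [H3 H4]]]. split; [|split; [|split]].
  - intros i. apply (branch_ext a P); auto.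
  - intros d Hd. rewrite <- E; auto.
  - exact H3.
  - intros L. destruct (H4 L) as [H5 H6]. split.
    + intros d Hd. rewrite <- E; [auto|]. apply C_lt. apply Hd.
    + intros B i. apply (follower_ext a P); auto.
Qed.

(** A stage consults only earlier stages, since [C a] lies below [a]. With extensionality the
    predicates given to [epsilon] become equal, hence so do the choices; this justifies unfolding
    the recursion. *)
Lemma next_ext a P Q : (forall b, b ≺ a -> P b = Q b) -> next a P = next a Q.
Proof.
  intros E. assert (E' : forall b, b ≺ a -> Q b = P b). { intros b Hb. symmetry. auto. }
  assert (EA : next_asc a P = next_asc a Q).
  { extensionality u. unfold next_asc. f_equal. extensionality g.
    apply propositional_extensionality. split; apply asc_spec_ext; auto. }
  assert (EL : next_lv a P = next_lv a Q).
  { extensionality y. unfold next_lv. rewrite EA. apply propositional_extensionality.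
    split; intros [H1 [H2 H3]]; (split; [|split]); auto.
    - apply (branch_ext a P); auto.
    - intros L G. destruct (H3 L G) as [F|F]; auto. left. apply (follower_ext a P); auto.
    - apply (branch_ext a Q); auto.
    - intros L G. destruct (H3 L G) as [F|F]; auto. left. apply (follower_ext a Q); auto. }
  unfold next. unfold next_jump. rewrite EA, EL. reflexivity.
Qed.

(** The recursive calls are padded above [a] by a dummy stage so that [next] receives a total
    function; by [next_ext] the padding has no effect. *)
Definition st : K -> stage :=
  Fix lt_wf (fun _ => stage) (fun a rec => next a (fun b =>
    match excluded_middle_informative (b ≺ a) with
    | left h => rec b h
    | right _ => Stage (fun _ => False) (fun _ _ _ => None) (fun _ _ => None)
    end)).

Lemma st_eq a : st a = next a st.
Proof.
  unfold st at 1. rewrite Fix_eq.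
  - apply next_ext. intros b Hb. destruct (excluded_middle_informative (b ≺ a)); [reflexivity|contradiction].
  - intros x f g H. apply next_ext. intros b Hb.
    destruct (excluded_middle_informative (b ≺ x)); [apply H|reflexivity].
Qed.

Local Notation T a := (lv (st a)).
Local Notation F a := (asc (st a)).
Local Notation J a := (jump (st a)).

Lemma T_eq a : T a = next_lv a st.
Proof. rewrite st_eq at 1. reflexivity. Qed.
Lemma F_eq a : F a = next_asc a st.
Proof. rewrite st_eq at 1. reflexivity. Qed.

Lemma T_node a y : T a y -> is_node lt y a.
Proof. rewrite T_eq. intros H. apply H. Qed.

Lemma T_restr a y b : T a y -> b ≼ a -> T b (restr y b).
Proof.
  intros H [L| ->].
  - rewrite T_eq in H. apply H. exact L.
  - rewrite (restr_id _ _ (T_node _ _ H)). exact H.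
Qed.

(** Together with [ascends], this is the induction hypothesis carried along the construction. *)
Definition extendible (a : K) : Prop :=
  forall b x, b ≼ a -> T b x -> exists y, T a y /\ restr y b = x.

Definition ascends (a : K) : Prop :=
  forall u, U u -> is_node lt u a -> asc_spec a st u (F a u).

Lemma J_spec a b x : extendible a -> b ≼ a -> T b x ->
  T a (J a x) /\ restr (J a x) b = x /\
  ((exists y, T a y /\ restr y b = x /\ hit a y) -> hit a (J a x)).
Proof.
  intros HE Hb Hx.
  assert (EJ : J a x = next_jump a st x). { rewrite st_eq at 1. reflexivity. }
  assert (HS : exists y, (next_lv a st y /\ sub x y) /\
     ((exists z, (next_lv a st z /\ sub x z) /\ hit a z) -> hit a y)).
  { destruct (classic (exists z, (next_lv a st z /\ sub x z) /\ hit a z)) as [[z Hz]|N].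
    - exists z. tauto.
    - destruct (HE b x Hb Hx) as [y [H1 H2]]. exists y. split; [|tauto].
      split; [rewrite <- T_eq; exact H1|exact (restr_eq_sub _ _ _ H2)]. }
  apply (epsilon_spec (inhabits (fun _ : K => None))) in HS.
  change (epsilon _ _) with (next_jump a st x) in HS. rewrite <- EJ, <- T_eq in HS.
  destruct HS as [[H1 H2] H3]. split; [exact H1|]. split.
  - apply sub_eq_restr; [exact (T_node _ _ Hx)|exact H2].
  - intros [y [Hy [Ry Hh]]]. apply H3. exists y. split; [split; [exact Hy|]|exact Hh].
    exact (restr_eq_sub _ _ _ Ry).
Qed.

Lemma ascends_T a u i : ascends a ->
  (forall b, is_succ b a -> forall u i, U u -> is_node lt u a -> lab b u i ≺ mu b) ->
  U u -> is_node lt u a -> T a (F a u i).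
Proof.
  intros HA Hl Uu Nu. destruct (HA u Uu Nu) as [H1 [_ [H3 _]]].
  rewrite T_eq. split; [apply H1|]. split.
  - intros b v Hb E. rewrite (H3 b Hb) in E. injection E as <-. apply Hl; auto.
  - intros _ _. right. exists u, i. rewrite F_eq. auto.
Qed.

(** * Branches that follow the maps $J$ along $C_a$ from a given node *)

Section Path.
Context (a : K) (Ha : is_limit lt a).
Context (IH : forall e, e ≺ a -> extendible e).
Context (b : K) (x : node) (Hb : C a b) (Hx : T b x).

Definition path_node (e : K) (y : node) : Prop :=
  T e y /\ restr y b = x /\
  forall d d', consec (C a) d d' -> b ≼ d -> d' ≼ e -> restr y d' = J d' (restr y d).

Lemma path_restr e e' y : path_node e y -> b ≼ e' -> e' ≼ e -> path_node e' (restr y e').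
Proof.
  intros [H1 [H2 H3]] L1 L2. split; [exact (T_restr _ _ _ H1 L2)|]. split.
  - rewrite restr_restr; auto.
  - intros d d' Hd L L'. pose proof (proj1 (proj2 (proj2 Hd))).
    rewrite !restr_restr; [|left; ord|exact L']. apply H3; auto. ord.
Qed.

(** Induction along [C a]. At an accumulation point both nodes are unions of earlier, equal ones; at
    any other point both are the image under [J e] of the same node at the predecessor. *)
Lemma path_unique e : C a e -> b ≼ e -> forall y y', path_node e y -> path_node e y' -> y = y'.
Proof.
  induction (lt_wf e) as [e _ IHe]. intros He [L|<-] y y' Hy Hy'.
  2: { destruct Hy as [H1 [H2 _]], Hy' as [H1' [H2' _]].
       rewrite (restr_id _ _ (T_node _ _ H1)) in H2. rewrite (restr_id _ _ (T_node _ _ H1')) in H2'.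
       congruence. }
  assert (R : forall d, C a d -> b ≼ d -> d ≺ e -> restr y d = restr y' d).
  { intros d Hd L1 L2. apply (IHe d); auto; apply (path_restr e); auto; left; auto. }
  pose proof (T_node _ _ (proj1 Hy)) as Ny. pose proof (T_node _ _ (proj1 Hy')) as Ny'.
  destruct (classic (acc lt (C a) e)) as [A|A].
  - apply acc_iff in A. destruct A as [_ [_ A]].
    apply (node_ext _ _ e); auto. intros c Lc.
    destruct (classic (c ≺ b)) as [Lcb|Lcb].
    + rewrite <- (restr_lt y b c Lcb), <- (restr_lt y' b c Lcb).
      destruct Hy as [_ [-> _]], Hy' as [_ [-> _]]. reflexivity.
    + destruct (A c Lc) as [d [Hd [L1 L2]]].
      rewrite <- (restr_lt y d c L1), <- (restr_lt y' d c L1), R; auto. left. ord.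
  - destruct (consec_pred a b e) as [d [Hd Ld]]; auto.
    pose proof (proj1 (proj2 (proj2 Hd))) as Lde.
    rewrite <- (restr_id _ _ Ny), <- (restr_id _ _ Ny').
    rewrite (proj2 (proj2 Hy) d e), (proj2 (proj2 Hy') d e); auto using le_refl.
    rewrite R; auto. apply Hd.
Qed.

(** Coherence makes [C e] equal to [C a] below [e] in both cases, so the union of the earlier path
    nodes is a follower at [e] too. Hence it survives at height [e] whatever the cofinality of
    [e]. *)
Lemma path_limit e : (e = a \/ acc lt (C a) e) -> b ≺ e ->
  (forall d, C a d -> b ≼ d -> d ≺ e -> exists y, path_node d y) ->
  exists y, path_node e y /\ follower e st y.
Proof.
  intros He Lbe HP.
  assert (Le : is_limit lt e). { destruct He as [-> |He]; [exact Ha|exact (acc_limit _ _ He)]. }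
  assert (HC : forall d, C e d <-> C a d /\ d ≺ e).
  { destruct He as [-> |He]; [|exact (C_coherent a e He)].
    intros d. split; [|tauto]. intros H. split; [exact H|exact (C_lt _ _ H)]. }
  assert (Hcof : cofinal_in (fun d => C a d /\ b ≼ d /\ d ≺ e) e).
  { intros c Lc. assert (exists m, b ≼ m /\ c ≼ m /\ m ≺ e) as [m [M1 [M2 M3]]].
    { destruct (classic (b ≺ c)) as [L|L].
      - exists c. repeat split; auto using le_refl. left; auto.
      - exists b. repeat split; auto using le_refl. ord. }
    destruct (C_cofinal e Le m M3) as [d [Hd [L1 L2]]]. apply HC in Hd.
    exists d. repeat split; try tauto; ord. }
  destruct (choice_on (fun _ => None) (fun d => C a d /\ b ≼ d /\ d ≺ e) path_node) as [s Hs].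
  { intros d [D1 [D2 D3]]. auto. }
  destruct (node_union (fun d => C a d /\ b ≼ d /\ d ≺ e) e s Hcof) as [y [Ny Ry]].
  - intros d Hd. exact (T_node _ _ (proj1 (Hs d Hd))).
  - intros d d' Hd Hd' L. apply (path_unique d); try tauto; [|apply Hs; exact Hd].
    apply (path_restr d'); [apply Hs; exact Hd'|tauto|left; exact L].
  - assert (Fy : forall d d', consec (C a) d d' -> b ≼ d -> d' ≺ e -> restr y d' = J d' (restr y d)).
    { intros d d' Hd L L'. pose proof Hd as [D1 [D2 [D3 D4]]].
      assert (Hd' : C a d' /\ b ≼ d' /\ d' ≺ e). { repeat split; auto. left; ord. }
      assert (Hd0 : C a d /\ b ≼ d /\ d ≺ e). { repeat split; auto. ord. }
      pose proof (Hs d' Hd') as Hp.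
      rewrite <- (restr_restr y d d' (or_introl D3)), Ry; auto.
      rewrite <- (proj2 (proj2 Hp) d d' Hd L (le_refl d')).
      symmetry. apply restr_id. exact (T_node _ _ (proj1 Hp)). }
    assert (Fol : follower e st y).
    { exists b. split; [apply HC; auto|]. intros d d' Hd L. apply Fy; auto.
      - destruct He as [-> |He]; [exact Hd|exact (consec_coherent a e d d' He Hd)].
      - apply C_lt, Hd. }
    exists y. split; [|exact Fol]. split; [|split].
    + rewrite T_eq. split; [|split].
      * split; [exact Ny|]. intros c Lc. destruct (Hcof c Lc) as [d [Hd [L1 L2]]].
        rewrite <- (restr_restr y c d (or_introl L1)), Ry; auto.
        apply (T_restr d); [apply Hs; exact Hd|left; exact L1].
      * intros c v Hc. destruct (limit_not_succ _ _ Le Hc).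
      * intros _ _. left. exact Fol.
    + assert (Hbb : C a b /\ b ≼ b /\ b ≺ e). { auto using le_refl. }
      rewrite Ry; auto. destruct (Hs b Hbb) as [P1 [P2 _]].
      rewrite (restr_id _ _ (T_node _ _ P1)) in P2. exact P2.
    (* The case where [d'] is [e] cannot occur: [a] is not in [C a], and an accumulation point has
       no predecessor in [C a]. *)
    + intros d d' Hd L [L'| ->]; [apply Fy; auto|]. exfalso.
      destruct He as [-> |He]; [exact (lt_irrefl _ (C_lt _ _ (proj1 (proj2 Hd))))|].
      destruct Hd as [D1 [D2 [D3 D4]]]. destruct (C_cofinal e Le d D3) as [c [Hc [L1 L2]]].
      apply HC in Hc. specialize (D4 c (proj1 Hc) L1). ord.
Qed.

Lemma path_exists e : C a e -> b ≼ e -> exists y, path_node e y.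
Proof.
  induction (lt_wf e) as [e _ IHe]. intros He [L|<-].
  - destruct (classic (acc lt (C a) e)) as [A|A].
    + destruct (path_limit e) as [y [Hy _]]; auto. exists y. exact Hy.
    + destruct (consec_pred a b e) as [d [Hd Ld]]; auto.
      pose proof Hd as [D1 [D2 [D3 D4]]].
      destruct (IHe d D3 D1 Ld) as [z [Z1 [Z2 Z3]]].
      destruct (J_spec e d z (IH e (C_lt _ _ He)) (or_introl D3) Z1) as [J1 [J2 _]].
      exists (J e z). split; [exact J1|]. split.
      * rewrite <- (restr_restr _ b d Ld), J2. exact Z2.
      * intros c c' Hc L1 L2. pose proof Hc as [C1 [C2 [C3 C4]]].
        destruct (lt_total c d) as [Lc|[->|Lc]].
        -- pose proof (C4 d D1 Lc) as L3.
           rewrite <- (restr_restr _ c' d L3), <- (restr_restr _ c d (or_introl Lc)), J2. auto.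
        -- assert (c' = e) as ->. { apply le_antisym; auto. }
           rewrite J2. apply restr_id. exact (T_node _ _ J1).
        -- pose proof (D4 c C1 Lc). ord.
  - exists x. split; [exact Hx|]. split; [exact (restr_id _ _ (T_node _ _ Hx))|].
    intros d d' [_ [_ [L _]]] L1 L2. ord.
Qed.

Lemma follower_exists : exists y, T a y /\ restr y b = x /\ follower a st y.
Proof.
  destruct (path_limit a) as [y [Hy Fy]]; auto using C_lt.
  - intros d Hd L _. apply path_exists; auto.
  - exists y. destruct Hy as [H1 [H2 _]]. auto.
Qed.

End Path.

(** * Every node extends to every greater height, and the ascent path exists at every height *)

Context (Hchi : infinite_cardinal lt chi) (HU : kappa_tree lt U).
Context (Hlab : forall b,
  chi ≼ mu b /\ b ≼ mu b /\
  forall a, is_succ b a ->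
    (forall u i, U u -> is_node lt u a -> lab b u i ≺ mu b) /\
    (forall u i v j, U u -> is_node lt u a -> U v -> is_node lt v a ->
        lab b u i = lab b v j -> u = v /\ i = j)).

Lemma is_succ_inj b b' a : is_succ b a -> is_succ b' a -> b = b'.
Proof.
  intros [H1 H2] [H3 H4]. destruct (lt_total b b') as [L|[L|L]]; [|exact L|].
  - specialize (H2 _ L). ord.
  - specialize (H4 _ L). ord.
Qed.

Lemma is_succ_lt b a c : is_succ b a -> c ≺ a -> c ≼ b.
Proof. intros [H1 H2] L. apply not_lt. intros L'. specialize (H2 _ L'). ord. Qed.

Lemma strict_sub_of_restr x y a b :
  is_node lt x a -> is_node lt y b -> a ≺ b -> restr y a = x -> strict_sub x y.
Proof.
  intros Hx Hy L E. split; [exact (restr_eq_sub _ _ _ E)|].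
  intros ->. apply (lt_irrefl b). rewrite <- (node_level_unique _ _ _ Hx Hy) at 1. exact L.
Qed.

Lemma U_restr u a b : U u -> is_node lt u a -> b ≼ a -> U (restr u b).
Proof.
  intros Uu Nu [L| ->].
  - assert (Nr : is_node lt (restr u b) b). { apply (restr_node u a); [exact Nu|left; exact L]. }
    apply (proj2 (proj1 HU) _ u); [exact Uu|exists b; exact Nr|].
    exact (strict_sub_of_restr _ _ _ _ Nr Nu L eq_refl).
  - rewrite (restr_id _ _ Nu). exact Uu.
Qed.

Lemma T_extend a b x v : T b x -> is_succ b a -> v ≺ mu b -> T a (extend x b v).
Proof.
  intros Hx Hb Hv. rewrite T_eq. split; [|split].
  - split; [exact (extend_node _ _ _ _ (T_node _ _ Hx) Hb)|].
    intros c Lc. pose proof (is_succ_lt _ _ _ Hb Lc) as L.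
    rewrite restr_extend by exact L. exact (T_restr _ _ _ Hx L).
  - intros b' w Hb' E. rewrite <- (is_succ_inj _ _ _ Hb Hb') in *. rewrite extend_at in E. congruence.
  - intros L. destruct (limit_not_succ _ _ L Hb).
Qed.

Lemma F_T a u i : ascends a -> U u -> is_node lt u a -> T a (F a u i).
Proof.
  intros HA Uu Nu. apply ascends_T; auto. intros b Hb. apply (proj2 (proj2 (Hlab b)) a Hb).
Qed.

Lemma F_node a u i : ascends a -> U u -> is_node lt u a -> is_node lt (F a u i) a.
Proof. intros HA Uu Nu. apply T_node, F_T; auto. Qed.

Lemma ascends_of_exists a :
  (forall u, U u -> is_node lt u a -> exists g, asc_spec a st u g) -> ascends a.
Proof.
  intros H u Uu Nu. rewrite F_eq.
  apply (epsilon_spec (inhabits (fun (_ : nat) (_ : K) => None)) (asc_spec a st u)). auto.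
Qed.

Lemma extendible_limit a : is_limit lt a -> (forall e, e ≺ a -> extendible e) -> extendible a.
Proof.
  intros Ha IH b x [L| ->] Hx.
  2: { exists x. split; [exact Hx|exact (restr_id _ _ (T_node _ _ Hx))]. }
  destruct (C_cofinal a Ha b L) as [c [Hc [L1 L2]]].
  destruct (IH c L2 b x (or_introl L1) Hx) as [y [Hy Ry]].
  destruct (follower_exists a Ha IH c y Hc Hy) as [z [Hz [Rz _]]].
  exists z. split; [exact Hz|]. rewrite <- (restr_restr z b c (or_introl L1)), Rz. exact Ry.
Qed.

Lemma branch_of_cofinal a (D : K -> Prop) y : is_node lt y a -> cofinal_in D a ->
  (forall d, D d -> d ≺ a -> T d (restr y d)) -> branch a st y.
Proof.
  intros Ny HD HT. split; [exact Ny|]. intros b Lb. destruct (HD b Lb) as [d [Hd [L1 L2]]].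
  rewrite <- (restr_restr y b d (or_introl L1)). apply (T_restr d); [auto|left; exact L1].
Qed.

(** Earlier values agree for every index along the accumulation points of [C a], so each index
    yields a union. At another height [d], agreement for almost all indices is inherited from an
    accumulation point above [d]. *)
Lemma ascends_limit_unbounded a u : is_limit lt a -> (forall e, e ≺ a -> ascends e) ->
  U u -> is_node lt u a -> ~ (exists b, b ≺ a /\ forall d, acc lt (C a) d -> d ≼ b) ->
  exists g, asc_spec a st u g.
Proof.
  intros Ha IH Uu Nu NB.
  assert (accl : forall d, acc lt (C a) d -> d ≺ a). { intros d Hd. apply C_lt, Hd. }
  assert (Hcof : cofinal_in (acc lt (C a)) a).
  { intros b Lb. apply NNPP. intros N. apply NB. exists b. split; [exact Lb|].
    intros d Hd. apply not_lt. intros L. apply N. exists d. auto. }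
  assert (UT : forall d i, d ≺ a -> T d (F d (restr u d) i)).
  { intros d i L. apply F_T; auto.
    - apply (U_restr u a); auto. left; exact L.
    - apply (restr_node u a); auto. left; exact L. }
  destruct (choice (fun i y => is_node lt y a /\
     forall d, acc lt (C a) d -> d ≺ a -> restr y d = F d (restr u d) i)) as [g Hg].
  { intros i. apply (node_union _ a (fun d => F d (restr u d) i) Hcof).
    - intros d Hd. apply T_node, UT; auto.
    - intros d e Hd He L. pose proof (accl e He) as Le.
      destruct (IH e Le (restr u e)) as [_ [_ [_ H]]].
      + apply (U_restr u a); auto. left; exact Le.
      + apply (restr_node u a); auto. left; exact Le.
      + destruct (H (acc_limit _ _ He)) as [H' _].
        rewrite (H' d (acc_trans a e d He Hd L) i), restr_restr; [reflexivity|left; exact L]. }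
  exists g. split; [|split; [|split]].
  - intros i. apply (branch_of_cofinal a (acc lt (C a))); [apply Hg|exact Hcof|].
    intros d Hd L. rewrite (proj2 (Hg i) d Hd L). auto.
  - intros d Ld. destruct (Hcof d Ld) as [e [He [L1 L2]]].
    destruct (IH e L2 (restr u e)) as [_ [H _]].
    + apply (U_restr u a); auto. left; exact L2.
    + apply (restr_node u a); auto. left; exact L2.
    + apply (cofinite_mono _ _) with (2 := H d L1). intros i E.
      rewrite restr_restr in E by (left; exact L1). rewrite <- E.
      rewrite <- (proj2 (Hg i) e He L2). symmetry. apply restr_restr. left; exact L1.
  - intros b Hb. destruct (limit_not_succ _ _ Ha Hb).
  - intros _. split; [|intros B; contradiction].
    intros d Hd i. apply (proj2 (Hg i)); auto.
Qed.

(** Past [g0], the least point of [C a] bounding all accumulation points, no accumulation occurs, so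
    the increasing sequence [gm] is cofinal in [a]. The [i]-th branch makes [i] attempts to climb
    the earlier path along [gm], then follows $J$. *)
Lemma ascends_limit_bounded a u : is_limit lt a ->
  (forall e, e ≺ a -> extendible e) -> (forall e, e ≺ a -> ascends e) ->
  U u -> is_node lt u a -> (exists b, b ≺ a /\ forall d, acc lt (C a) d -> d ≼ b) ->
  exists g, asc_spec a st u g.
Proof.
  intros Ha IHe IH Uu Nu [b [Lb Bb]].
  destruct (wf_min (fun g => C a g /\ forall d, acc lt (C a) d -> d ≼ g)) as [g0 [[Cg0 Ag0] Mg0]].
  { destruct (C_cofinal a Ha b Lb) as [c [Hc [L1 L2]]]. exists c. split; [exact Hc|].
    intros d Hd. specialize (Bb d Hd). left. ord. }
  (* If [g0] were not an accumulation point while some accumulation point lies below it, the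
     predecessor of [g0] in [C a] would also be a bound, against minimality. *)
  assert (Acc0 : forall d, acc lt (C a) d -> d = g0 \/ d ≺ g0 /\ acc lt (C a) g0).
  { intros d Hd. destruct (Ag0 d Hd) as [L|E]; [right|left; exact E].
    split; [exact L|]. apply NNPP. intros NA.
    destruct (consec_pred a d g0) as [p [[P1 [P2 [P3 P4]]] _]]; auto; [apply Hd|].
    assert (g0 ≼ p); [|ord]. apply Mg0. split; [exact P1|].
    intros e He. apply not_lt. intros Lp. specialize (P4 e (proj1 He) Lp).
    apply NA. replace g0 with e; [exact He|]. apply le_antisym; auto. }
  destruct (choice_on g0 (C a) (fun c e => C a e /\ c ≺ e)) as [nx Hnx].
  { intros c Hc. destruct (C_cofinal a Ha c (C_lt _ _ Hc)) as [e [He [L _]]]. exists e. auto. }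
  pose (gm := fun n => Nat.iter n nx g0).
  assert (Cgm : forall n, C a (gm n)).
  { intros n. induction n as [|n IHn]; [exact Cg0|]. apply (Hnx _ IHn). }
  assert (Sgm : forall n, gm n ≺ gm (S n)). { intros n. apply (Hnx _ (Cgm n)). }
  assert (Mgm : forall n m, n <= m -> gm n ≼ gm m).
  { intros n m L. induction L as [|m L IHm]; [apply le_refl|]. pose proof (Sgm m). left. ord. }
  assert (Lgm : forall n, gm n ≺ a). { intros n. apply C_lt, Cgm. }
  (* If the [gm n] were bounded below [a], their supremum would be an accumulation point of [C a]
     above [g0]. *)
  assert (Hcof : forall c, c ≺ a -> exists n, c ≺ gm n).
  { intros c Lc. apply NNPP. intros N.
    destruct (least_upper_bound (fun d => exists n, d = gm n) c) as [s [S1 S2]].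
    { intros d [n ->]. apply not_lt. intros L. apply N. exists n. exact L. }
    assert (S1' : forall n, gm n ≼ s). { intros n. apply S1. exists n. reflexivity. }
    assert (Lsc : s ≼ c).
    { apply not_lt. intros L. destruct (S2 c L) as [d [[n ->] L']]. apply N. exists n. exact L'. }
    assert (Cs : cofinal_in (C a) s).
    { intros t Lt. destruct (S2 t Lt) as [d [[n ->] L']]. exists (gm n).
      split; [apply Cgm|]. split; [exact L'|]. pose proof (Sgm n). pose proof (S1' (S n)). ord. }
    assert (As' : acc lt (C a) s).
    { assert (exists t, t ≺ s). { exists (gm 0). pose proof (Sgm 0). pose proof (S1' 1). ord. }
      apply acc_iff. split; [|auto]. apply C_closed; auto. ord. }
    pose proof (Ag0 s As'). pose proof (Sgm 0). pose proof (S1' 1). change (gm 0) with g0 in *. ord. }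
  pose (ff := fun n i => F (gm n) (restr u (gm n)) i).
  assert (HUg : forall n, U (restr u (gm n))).
  { intros n. apply (U_restr u a); auto. left; auto. }
  assert (HNg : forall n, is_node lt (restr u (gm n)) (gm n)).
  { intros n. apply (restr_node u a); auto. left; auto. }
  assert (HTf : forall n i, T (gm n) (ff n i)). { intros n i. apply F_T; auto. }
  (* [idx i k] is the position reached after [k] attempts with index [i]: it moves to [S k] exactly
     when the path value there extends the value at the current position. For fixed [m], almost
     every [i] is at [m] after [m] attempts. *)
  pose (idx := fun i => nat_rect (fun _ => nat) 0 (fun k m =>
     if excluded_middle_informative (restr (ff (S k) i) (gm m) = ff m i) then S k else m)).
  assert (Idx : forall i k, idx i k <= k).
  { intros i k. induction k as [|k IHk]; [apply Nat.le_refl|].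
    change (idx i (S k)) with (if excluded_middle_informative
      (restr (ff (S k) i) (gm (idx i k)) = ff (idx i k) i) then S k else idx i k).
    destruct (excluded_middle_informative _); lia. }
  assert (Mono : forall i k k', k <= k' ->
    idx i k <= idx i k' /\ restr (ff (idx i k') i) (gm (idx i k)) = ff (idx i k) i).
  { intros i k k' L. induction L as [|k' L IHk].
    - split; [apply Nat.le_refl|]. apply restr_id. exact (T_node _ _ (HTf _ _)).
    - change (idx i (S k')) with (if excluded_middle_informative
        (restr (ff (S k') i) (gm (idx i k')) = ff (idx i k') i) then S k' else idx i k').
      destruct (excluded_middle_informative _) as [E|E]; [|exact IHk].
      pose proof (Idx i k). split; [lia|]. destruct IHk as [I1 I2].
      rewrite <- (restr_restr _ _ _ (Mgm _ _ I1)), E. exact I2. }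
  assert (Hcf : forall m, cofinite (fun i => idx i m = m)).
  { intros m. induction m as [|m IHm]; [exists 0; reflexivity|].
    destruct (IH (gm (S m)) (Lgm _) (restr u (gm (S m))) (HUg _) (HNg _)) as [_ [H _]].
    specialize (H (gm m) (Sgm m)). rewrite restr_restr in H by (left; apply Sgm).
    apply (cofinite_mono _ _) with (2 := cofinite_and _ _ IHm H). intros i [E1 E2].
    change (idx i (S m)) with (if excluded_middle_informative
      (restr (ff (S m) i) (gm (idx i m)) = ff (idx i m) i) then S m else idx i m).
    rewrite E1. destruct (excluded_middle_informative _) as [|N]; [reflexivity|].
    destruct N. exact E2. }
  destruct (choice (fun i y => T a y /\ restr y (gm (idx i i)) = ff (idx i i) i /\ follower a st y))
    as [g Hg].
  { intros i. apply follower_exists; auto. }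
  assert (Rg : forall i k, k <= i -> restr (g i) (gm (idx i k)) = ff (idx i k) i).
  { intros i k L. destruct (Mono i k i L) as [M1 M2].
    rewrite <- (restr_restr (g i) _ _ (Mgm _ _ M1)).
    rewrite (proj1 (proj2 (Hg i))). exact M2. }
  exists g. split; [|split; [|split]].
  - intros i. destruct (Hg i) as [H _]. rewrite T_eq in H. apply H.
  - intros d Ld. destruct (Hcof d Ld) as [m Lm].
    destruct (IH (gm m) (Lgm _) (restr u (gm m)) (HUg _) (HNg _)) as [_ [H _]].
    specialize (H d Lm). rewrite restr_restr in H by (left; exact Lm).
    assert (Hm : cofinite (fun i => m <= i)). { exists m. auto. }
    apply (cofinite_mono _ _) with (2 := cofinite_and _ _ Hm (cofinite_and _ _ (Hcf m) H)).
    intros i [E1 [E2 E3]]. specialize (Rg i m E1). rewrite E2 in Rg.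
    rewrite <- (restr_restr (g i) d (gm m)) by (left; exact Lm). rewrite Rg. exact E3.
  - intros c Hc. destruct (limit_not_succ _ _ Ha Hc).
  - intros _. split; [|intros _ i; apply Hg].
    (* Position 0 is never undone, so every [g i] extends the path value at [g0]. This gives exact
       agreement at [g0], and at lower accumulation points through the specification at [g0]. *)
    intros d Hd i. pose proof (Rg i 0 (Nat.le_0_l i)) as R0. change (gm (idx i 0)) with g0 in R0.
    destruct (Acc0 d Hd) as [-> |[L A]]; [exact R0|].
    rewrite <- (restr_restr (g i) d g0) by (left; exact L). rewrite R0.
    destruct (IH g0 (Lgm 0) (restr u g0) (HUg 0) (HNg 0)) as [_ [_ [_ H]]].
    destruct (H (acc_limit _ _ A)) as [H' _].
    etransitivity; [exact (H' d (acc_trans a g0 d A Hd L) i)|].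
    rewrite restr_restr; [reflexivity|left; exact L].
Qed.

Lemma extendible_ascends a : extendible a /\ ascends a.
Proof.
  induction (lt_wf a) as [a _ IH0].
  assert (IHe : forall e, e ≺ a -> extendible e). { intros e L. apply (IH0 e L). }
  assert (IH : forall e, e ≺ a -> ascends e). { intros e L. apply (IH0 e L). }
  clear IH0. destruct (zero_succ_limit a) as [Z|[[b Hb]|Ha]].
  - split.
    + intros b x [L| ->] Hx; [destruct (Z b L)|].
      exists x. split; [exact Hx|exact (restr_id _ _ (T_node _ _ Hx))].
    + apply ascends_of_exists. intros u Uu Nu. exists (fun _ _ => None). split; [|split; [|split]].
      * intros i. split; [|intros b L; destruct (Z b L)].
        intros b. split; intros H; [destruct (Z b H)|congruence].
      * intros d L. destruct (Z d L).
      * intros b [L _]. destruct (Z b L).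
      * intros [[b L] _]. destruct (Z b L).
  - pose proof (proj1 Hb) as Lb. split.
    + intros d x [L| ->] Hx.
      2: { exists x. split; [exact Hx|exact (restr_id _ _ (T_node _ _ Hx))]. }
      pose proof (is_succ_lt _ _ _ Hb L) as Ld.
      destruct (IHe b Lb d x Ld Hx) as [y [Hy Ry]].
      (* Any ordinal below [chi] may be appended, as [chi] is at most [mu b]; [f 0] is one. *)
      destruct (proj1 Hchi) as [f [Hf _]].
      exists (extend y b (f 0)). split.
      * apply T_extend; auto. pose proof (Hf 0 I) as Hf0. unfold seg in Hf0.
        destruct (Hlab b) as [Hm _]. ord.
      * rewrite restr_extend by exact Ld. exact Ry.
    + apply ascends_of_exists. intros u Uu Nu.
      assert (Uub : U (restr u b)). { apply (U_restr u a); auto. left; exact Lb. }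
      assert (Nub : is_node lt (restr u b) b). { apply (restr_node u a); auto. left; exact Lb. }
      assert (HF : forall i, T b (F b (restr u b) i)). { intros i. apply F_T; auto. }
      exists (fun i => extend (F b (restr u b) i) b (lab b u i)). split; [|split; [|split]].
      * intros i. assert (H : T a (extend (F b (restr u b) i) b (lab b u i))).
        { apply T_extend; auto. apply (proj2 (proj2 (Hlab b)) a Hb); auto. }
        rewrite T_eq in H. apply H.
      * intros d L. destruct (is_succ_lt _ _ _ Hb L) as [Ld| ->].
        -- destruct (IH b Lb (restr u b) Uub Nub) as [_ [H _]].
           apply (cofinite_mono _ _) with (2 := H d Ld). intros i E.
           rewrite restr_extend by (left; exact Ld). rewrite E.
           rewrite restr_restr; [reflexivity|left; exact Ld].
        -- exists 0. intros i _. rewrite restr_extend by apply le_refl.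
           exact (restr_id _ _ (T_node _ _ (HF i))).
      * intros b' Hb' i. rewrite <- (is_succ_inj _ _ _ Hb Hb'). apply extend_at.
      * intros L. destruct (limit_not_succ _ _ L Hb).
  - split; [exact (extendible_limit a Ha IHe)|].
    apply ascends_of_exists. intros u Uu Nu.
    destruct (classic (exists b, b ≺ a /\ forall d, acc lt (C a) d -> d ≼ b)) as [B|B].
    + apply ascends_limit_bounded; auto.
    + apply ascends_limit_unbounded; auto.
Qed.

Lemma all_extendible a : extendible a.
Proof. apply extendible_ascends. Qed.
Lemma all_ascends a : ascends a.
Proof. apply extendible_ascends. Qed.

(** * Levels are small, and completeness *)

Context (Hpow : forall lam : K, small_power lt lam chi).

Definition tree (y : node) : Prop := exists a, T a y.

Lemma level_tree a y : level lt tree a y <-> T a y.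
Proof.
  split.
  - intros [[b Hb] Ny]. rewrite (node_level_unique _ _ _ Ny (T_node _ _ Hb)). exact Hb.
  - intros H. split; [exists a; exact H|exact (T_node _ _ H)].
Qed.

Lemma T_of_tree a y : tree y -> is_node lt y a -> T a y.
Proof. intros H N. apply level_tree. split; assumption. Qed.

Lemma zero_exists : exists z, forall b, z ≼ b.
Proof.
  destruct inhabited_index as [k0].
  destruct (wf_min (fun _ => True) (ex_intro _ k0 I)) as [z [_ Hz]]. exists z. auto.
Qed.

Lemma T_zero z : (forall b, z ≼ b) -> T z (fun _ => None).
Proof.
  intros Hz. rewrite T_eq. split; [|split].
  - split.
    + intros b. split; intros H; [specialize (Hz b); ord|congruence].
    + intros b L. specialize (Hz b). ord.
  - intros b v Hb E. discriminate.
  - intros [[b L] _]. specialize (Hz b). ord.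
Qed.

Lemma T_nonempty a : exists y, T a y.
Proof.
  destruct zero_exists as [z Hz].
  destruct (all_extendible a z _ (Hz a) (T_zero z Hz)) as [y [Hy _]]. exists y. exact Hy.
Qed.

Lemma small_or {X : Type} (A B : X -> Prop) : small A -> small B -> small (fun x => A x \/ B x).
Proof.
  intros HA HB.
  apply (small_incl _ (fun x => exists b : bool, True /\ (if b then A else B) x)).
  - intros x [H|H]; [exists true|exists false]; auto.
  - apply small_union.
    + apply small_nat. exists (fun b : bool => if b then 0 else 1). split; [auto|].
      intros [] []; simpl; congruence.
    + intros [] _; assumption.
Qed.

Lemma follower_unique a b y y' : is_limit lt a -> C a b -> T a y -> T a y' ->
  follows (C a) (fun e => J e) b y -> follows (C a) (fun e => J e) b y' ->
  restr y b = restr y' b -> y = y'.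
Proof.
  intros Ha Hb Hy Hy' F1 F2 E. pose proof (C_lt _ _ Hb) as Lb.
  assert (Hx : T b (restr y b)). { apply (T_restr a); auto. left; exact Lb. }
  assert (HP : forall w d, T a w -> restr w b = restr y b ->
    follows (C a) (fun e => J e) b w -> C a d -> b ≼ d -> path_node a b (restr y b) d (restr w d)).
  { intros w d Hw Rw Fw Hd L. split; [|split].
    - apply (T_restr a); auto. left. auto.
    - rewrite restr_restr; auto.
    - intros c c' Hc L1 L2. pose proof (proj1 (proj2 (proj2 Hc))).
      rewrite !restr_restr; [|left; ord|exact L2]. apply Fw; auto. }
  apply (node_ext _ _ a); [apply T_node; exact Hy|apply T_node; exact Hy'|].
  intros c Lc. assert (exists d, C a d /\ b ≼ d /\ c ≺ d) as [d [Hd [L1 L2]]].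
  { destruct (C_cofinal a Ha c Lc) as [d [Hd [L1 L2]]].
    destruct (C_cofinal a Ha b Lb) as [e [He [L3 L4]]].
    destruct (classic (d ≺ e)) as [L|L].
    - exists e. repeat split; auto; [left; exact L3|ord].
    - exists d. repeat split; auto. left; ord. }
  rewrite <- (restr_lt y d c L2), <- (restr_lt y' d c L2).
  rewrite (path_unique a Ha b (restr y b) Hb Hx d Hd L1 (restr y d) (restr y' d)); auto.
Qed.

(** At a limit of cofinality at least [chi], a follower is determined by its starting point [b] and
    its restriction to [b], and the other nodes by a pair [u], [i]. At other limits a branch is
    coded by its restrictions to a short cofinal set, and the hypothesis $\lambda^{<\chi}<\kappa$
    bounds the number of codes. *)
Lemma T_small a : small (T a).
Proof.
  induction (lt_wf a) as [a _ IH]. destruct (zero_succ_limit a) as [Z|[[b Hb]|Ha]].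
  - apply small_subsingleton. intros x y Hx Hy.
    apply (node_ext _ _ a); [exact (T_node _ _ Hx)|exact (T_node _ _ Hy)|].
    intros c L. destruct (Z c L).
  - pose proof (proj1 Hb) as Lb.
    apply (small_incl _ (fun y => exists x, T b x /\ exists v, v ≺ mu b /\ y = extend x b v)).
    + intros y Hy. exists (restr y b). split; [apply (T_restr a); [exact Hy|left; exact Lb]|].
      pose proof (T_node _ _ Hy) as Ny. destruct (node_Some _ _ _ Ny Lb) as [v Hv].
      exists v. split.
      * rewrite T_eq in Hy. apply Hy; auto.
      * apply (node_ext _ _ a); [exact Ny|apply extend_node; auto; apply (restr_node _ a); auto; left; auto|].
        intros c Lc. unfold extend. destruct (excluded_middle_informative (c = b)) as [->|N]; [exact Hv|].
        destruct (is_succ_lt _ _ _ Hb Lc) as [L|L]; [|contradiction]. rewrite restr_lt; auto.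
    + apply small_union; [exact (IH b Lb)|]. intros x _. apply small_image, small_seg.
  - destruct (classic (E_ge lt chi a)) as [G|NG].
    + apply (small_incl _ (fun y => (exists b, b ≺ a /\ exists x, T b x /\
          (C a b /\ T a y /\ follows (C a) (fun e => J e) b y /\ restr y b = x)) \/
        (exists u, level lt U a u /\ exists i : nat, True /\ y = F a u i))).
      * intros y Hy. pose proof Hy as Hy'. rewrite T_eq in Hy.
        destruct Hy as [_ [_ Hy]]. destruct (Hy Ha G) as [[b [Hb Fy]]|[u [i [Uu [Nu E]]]]].
        -- left. exists b. split; [exact (C_lt _ _ Hb)|]. exists (restr y b).
           split; [apply (T_restr a); [exact Hy'|left; exact (C_lt _ _ Hb)]|]. auto.
        -- right. exists u. split; [split; assumption|]. exists i. rewrite F_eq. auto.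
      * apply small_or.
        -- apply (small_union (seg lt a)); [apply small_seg|]. intros b Lb.
           apply small_union; [exact (IH b Lb)|]. intros x _. apply small_subsingleton.
           intros y y' [H1 [H2 [H3 H4]]] [H1' [H2' [H3' H4']]].
           apply (follower_unique a b); auto. congruence.
        -- apply small_union; [apply HU|]. intros u _. apply small_image, small_nat.
           exists (fun n => n). auto.
    + apply not_all_ex_not in NG. destruct NG as [A NG]. apply imply_to_and in NG.
      destruct NG as [[A1 A2] A3].
      assert (H0 : exists k, seg lt chi k).
      { destruct (proj1 Hchi) as [f [Hf _]]. exists (f 0). apply Hf. exact I. }
      (* Failure of [E_ge] gives only that [chi] does not inject into the cofinal set [A];
         comparability turns this into an injection [g] of [A] into some [th] below [chi]. *)
      destruct (card_le_or_seg _ _ H0 A3) as [th [Lth [g [Hg Ig]]]].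
      assert (SU : small (fun y => exists b, b ≺ a /\ T b y)).
      { apply (small_union (seg lt a)); [apply small_seg|exact IH]. }
      destruct (small_card_le_seg _ SU) as [lam [j [Hj Ij]]].
      destruct (proj1 Ha) as [a0 La0].
      (* [h] inverts [g]; off the range of [g] it takes the default [a0], so that its values always
         lie below [a]. *)
      destruct (choice (fun d c => c ≺ a /\ ((exists c', A c' /\ g c' = d) -> A c /\ g c = d))) as [h Hh].
      { intros d. destruct (classic (exists c', A c' /\ g c' = d)) as [[c' [Hc' E]]|N].
        - exists c'. auto.
        - exists a0. tauto. }
      apply (small_card_le _ (fun x : node => exists m, m ≺ chi /\ is_node lt x m /\
                                  forall c v, x c = Some v -> v ≺ lam)); [|exact (Hpow lam)].
      exists (fun y d => if excluded_middle_informative (d ≺ th) then Some (j (restr y (h d))) else None).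
      split.
      * intros y Hy. exists th. split; [exact Lth|]. split.
        -- intros d. destruct (excluded_middle_informative (d ≺ th)).
           ++ split; [congruence|auto].
           ++ split; [tauto|congruence].
        -- intros d v. destruct (excluded_middle_informative (d ≺ th)); [|discriminate].
           intros E. injection E as <-. apply Hj. exists (h d). split; [apply Hh|].
           apply (T_restr a); [exact Hy|left; apply Hh].
      * intros y y' Hy Hy' E.
        apply (node_ext _ _ a); [exact (T_node _ _ Hy)|exact (T_node _ _ Hy')|].
        intros c Lc. destruct (proj2 Ha c Lc) as [c1 [L1 L2]].
        destruct (A2 c1 L2) as [c2 [Hc2 L3]].
        assert (L4 : c ≺ c2) by ord.
        rewrite <- (restr_lt y c2 c L4), <- (restr_lt y' c2 c L4).
        pose proof (A1 c2 Hc2) as L5.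
        assert (Eh : h (g c2) = c2).
        { destruct (proj2 (Hh (g c2))) as [H1 H2]; [exists c2; auto|]. apply Ig; auto. }
        assert (E' := f_equal (fun x => x (g c2)) E). simpl in E'.
        destruct (excluded_middle_informative (g c2 ≺ th)) as [_|N]; [|destruct N; apply Hg; exact Hc2].
        rewrite Eh in E'. injection E' as E'. apply Ij in E'; [rewrite E'; reflexivity| |].
        -- exists c2. split; [exact L5|]. apply (T_restr a); [exact Hy|left; exact L5].
        -- exists c2. split; [exact L5|]. apply (T_restr a); [exact Hy'|left; exact L5].
Qed.

Lemma tree_kappa_tree : kappa_tree lt tree.
Proof.
  split; [split|split].
  - intros x [a H]. exists a. exact (T_node _ _ H).
  - intros x y [b Hy] [a Nx] [S _]. exists a.
    rewrite <- (sub_eq_restr _ _ _ Nx S). apply (T_restr b); [exact Hy|].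
    exact (sub_level _ _ _ _ Nx (T_node _ _ Hy) S).
  - intros a. destruct (T_nonempty a) as [y Hy]. exists y. apply level_tree. exact Hy.
  - intros a. apply (small_incl _ (T a)); [|apply T_small]. intros x. apply level_tree.
Qed.

Lemma tree_prolific : prolific lt tree.
Proof.
  intros x a i Tx Nx Hi y Hy. destruct (succ_exists a) as [a' Ha']. exists a'.
  replace y with (extend x a i).
  - apply T_extend; [exact (T_of_tree _ _ Tx Nx)|exact Ha'|].
    destruct (Hlab a) as [H1 [H2 _]]. destruct Hi as [Hi|Hi]; [|ord].
    pose proof (finite_ord_lt_infinite chi i Hchi Hi). ord.
  - extensionality c. unfold extend. destruct (Hy c) as [H1 [H2 H3]].
    destruct (excluded_middle_informative (c = a)) as [E|N]; [symmetry; auto|].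
    destruct (lt_total c a) as [L|[L|L]]; [symmetry; auto|contradiction|].
    rewrite (H3 L). apply (node_None _ _ _ Nx). ord.
Qed.

(** Without a last term, the union of the sequence has limit height [a], and the heights of the
    terms are cofinal in [a]. They number fewer than [chi], so all branches are kept at [a]. *)
Lemma tree_chi_complete : chi_complete lt chi tree.
Proof.
  intros th s Lth Hs Hinc.
  destruct (classic (exists d, d ≺ th)) as [[d0 Ld0]|N].
  2: { destruct zero_exists as [z Hz]. exists (fun _ => None). split; [exists z; apply T_zero, Hz|].
       intros d L. destruct N. exists d. exact L. }
  destruct (classic (exists d, d ≺ th /\ forall d', d' ≺ th -> d' ≼ d)) as [[d [Ld Hd]]|NM].
  { exists (s d). split; [auto|]. intros d' L. destruct (Hd d' L) as [L'| ->].
    - apply Hinc; auto.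
    - intros c v E. exact E. }
  assert (NM' : forall d, d ≺ th -> exists d', d ≺ d' /\ d' ≺ th).
  { intros d Ld. apply NNPP. intros N. apply NM. exists d. split; [exact Ld|].
    intros d' L'. apply not_lt. intros L. apply N. exists d'. auto. }
  destruct (choice_on d0 (fun d => d ≺ th) (fun d a => T a (s d)) Hs) as [l Hl].
  assert (Nl : forall d, d ≺ th -> is_node lt (s d) (l d)). { intros d L. apply T_node, Hl, L. }
  assert (Ml : forall d d', d ≺ d' -> d' ≺ th -> l d ≺ l d').
  { intros d d' L L'. assert (Ld : d ≺ th) by ord. destruct (Hinc d d' L L') as [S NE].
    destruct (sub_level _ _ _ _ (Nl d Ld) (Nl d' L') S) as [Q|Q]; [exact Q|].
    destruct NE. rewrite <- (sub_eq_restr _ _ _ (Nl d Ld) S), Q. apply restr_id. auto. }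
  assert (Il : forall d d', d ≺ th -> d' ≺ th -> l d = l d' -> d = d').
  { intros d d' L L' E. destruct (lt_total d d') as [Q|[Q|Q]]; [|exact Q|].
    - pose proof (Ml d d' Q L') as Q'. rewrite E in Q'. destruct (lt_irrefl _ Q').
    - pose proof (Ml d' d Q L) as Q'. rewrite E in Q'. destruct (lt_irrefl _ Q'). }
  pose (A := fun c => exists d, d ≺ th /\ c = l d).
  destruct (small_bounded A) as [bd Hbd]. { apply (small_image (seg lt th)), small_seg. }
  destruct (least_upper_bound A bd) as [a [S1 S2]]. { intros c Hc. left. auto. }
  assert (Al : forall d, d ≺ th -> A (l d)). { intros d L. exists d. auto. }
  assert (Aa : forall c, A c -> c ≺ a).
  { intros c [d [Ld ->]]. destruct (NM' d Ld) as [d' [L1 L2]].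
    pose proof (Ml d d' L1 L2). pose proof (S1 _ (Al d' L2)). ord. }
  assert (Hcof : cofinal_in A a).
  { intros t Lt. destruct (S2 t Lt) as [c [Hc L]]. exists c. auto. }
  assert (La : is_limit lt a). { apply (limit_of_cofinal A); [exists (l d0); auto|exact Hcof]. }
  destruct (choice_on d0 A (fun c d => d ≺ th /\ c = l d) (fun c H => H)) as [p Hp].
  destruct (node_union A a (fun c => s (p c)) Hcof) as [t [Nt Rt]].
  - intros c Hc. destruct (Hp c Hc) as [L E]. rewrite E at 2. auto.
  - intros c e Hc He L. destruct (Hp c Hc) as [L1 E1], (Hp e He) as [L2 E2].
    assert (Lp : p c ≺ p e).
    { apply not_le. intros [Q|Q].
      - pose proof (Ml _ _ Q L1). rewrite <- E1, <- E2 in *. ord.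
      - rewrite Q in E2. rewrite <- E2 in E1. subst e. destruct (lt_irrefl _ L). }
    rewrite E1 at 1. apply sub_eq_restr; auto. apply Hinc; auto.
  - exists t. split.
    + exists a. rewrite T_eq. split; [|split].
      * apply (branch_of_cofinal a A); auto. intros c Hc L. rewrite Rt by auto.
        destruct (Hp c Hc) as [L1 E]. rewrite E at 1. auto.
      * intros b v Hb. destruct (limit_not_succ _ _ La Hb).
      (* Otherwise [chi] would inject into [A] and thus into [th], against [chi] being a
         cardinal. *)
      * intros _ G. exfalso. apply (proj2 Hchi th Lth). apply (card_le_trans _ A).
        -- apply G. split; [exact Aa|]. intros b Lb. destruct (Hcof b Lb) as [c [Hc [L _]]].
           exists c. split; [exact Hc|left; exact L].
        -- exists p. split; [intros c Hc; apply (Hp c Hc)|].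
           intros c c' Hc Hc' E. destruct (Hp c Hc) as [_ ->], (Hp c' Hc') as [_ ->]. congruence.
    + intros d Ld. apply restr_eq_sub with (b := l d). rewrite Rt; auto.
      f_equal. destruct (Hp (l d) (Al d Ld)) as [L E]. symmetry. apply Il; auto.
Qed.

(** * Sealing antichains *)

Context (pi_inj : forall x y, Node lt x -> Node lt y -> pi x = pi y -> x = y).
Context (As_guess : forall X : K -> Prop, stationary lt (fun a => forall b, b ≺ a -> (X b <-> As a b))).

(* Nodes [F a u i] with [acc (C a)] unbounded need not follow [C a] themselves, but their
   restriction to any [g] accumulating [C a] right after an omega-block follows [C g], whose
   tail is that block. *)
Lemma level_jumps (G : K -> Prop) a y :
  E_ge lt chi a ->
  is_sup lt (fun b => C a b /\ forall d, succ_omega lt (fun c => C a c /\ b ≼ c) d -> G d) a ->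
  T a y -> exists d e, d ≺ e /\ e ≺ a /\ G e /\ restr y e = J e (restr y d).
Proof.
  intros Ga Hsup Hy.
  assert (Hcof : cofinal_in (fun b => C a b /\ forall d, succ_omega lt (fun c => C a c /\ b ≼ c) d -> G d) a).
  { intros t Lt. apply NNPP. intros N. assert (a ≼ t); [|ord]. apply Hsup. intros c Hc.
    apply not_lt. intros L. apply N. exists c. split; [exact Hc|]. split; [exact L|].
    apply C_lt, Hc. }
  assert (Ha0 : exists b, b ≺ a).
  { apply NNPP. intros N. destruct (Ga (fun _ => False)) as [f [Hf _]].
    - split; [tauto|]. intros b L. destruct N. exists b. exact L.
    - destruct (proj1 Hchi) as [q [Hq _]]. exact (Hf (q 0) (Hq 0 I)). }
  pose proof (limit_of_cofinal _ a Ha0 Hcof) as La.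
  (* A follower makes a $J$-step from a block's starting point [b] to the next point [e] of [C a],
     which is the first element of that block and so lies in [G]. *)
  assert (HF : follower a st y -> exists d e, d ≺ e /\ e ≺ a /\ G e /\ restr y e = J e (restr y d)).
  { intros [b0 [Hb0 Fy]]. destruct (Hcof b0 (C_lt _ _ Hb0)) as [b [[Hb HG] [L1 L2]]].
    destruct (consec_next a b La Hb) as [e He]. pose proof He as [_ [Ce [Lbe Hn]]].
    exists b, e. split; [exact Lbe|]. split; [exact (C_lt _ _ Ce)|]. split.
    - apply HG. split; [split; [exact Ce|left; exact Lbe]|]. split.
      + exists b. split; [split; [exact Hb|apply le_refl]|exact Lbe].
      + apply (finite_set_incl _ (fun c => False \/ c = b)).
        * intros c [[H1 H2] H3]. right. destruct H2 as [H2|H2]; [|auto].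
          specialize (Hn c H1 H2). ord.
        * apply finite_set_add, finite_set_empty. tauto.
    - apply Fy; [exact He|left; exact L1]. }
  pose proof Hy as Hy'. rewrite T_eq in Hy'. destruct Hy' as [_ [_ Hy']].
  destruct (Hy' La Ga) as [Fy|[u [i [Uu [Nu E]]]]]; [exact (HF Fy)|].
  rewrite <- F_eq in E. destruct (all_ascends a u Uu Nu) as [_ [_ [_ H4]]].
  destruct (H4 La) as [H5 H6].
  destruct (classic (exists b, b ≺ a /\ forall d, acc lt (C a) d -> d ≼ b)) as [B|B].
  { apply HF. rewrite E. auto. }
  destruct Ha0 as [k Lk]. destruct (Hcof k Lk) as [b [[Hb HG] [_ Lb]]].
  (* Let [g] be the first accumulation point above [b]: [C a] between [b] and [g] is the
     $\omega$-block of [b]. By coherence [C g] has no accumulation point above [b], so the path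
     value at [g] is a follower. *)
  destruct (wf_min (fun g => acc lt (C a) g /\ b ≺ g)) as [g [[Ag Lbg] Mg]].
  { apply NNPP. intros N. apply B. exists b. split; [exact Lb|]. intros d Hd.
    apply not_lt. intros L. apply N. exists d. auto. }
  pose proof (C_lt _ _ (proj1 Ag)) as Lga. pose proof (acc_limit _ _ Ag) as Lg.
  assert (Ug : U (restr u g)). { apply (U_restr u a); auto. left; exact Lga. }
  assert (Ng : is_node lt (restr u g) g). { apply (restr_node u a); auto. left; exact Lga. }
  destruct (all_ascends g (restr u g) Ug Ng) as [_ [_ [_ H7]]].
  destruct (H7 Lg) as [_ H8].
  destruct (H8) with (i := i) as [b1 [Hb1 Fg]].
  { exists b. split; [exact Lbg|]. intros d Hd. apply not_lt. intros L.
    pose proof (Mg d (conj (acc_C_acc a g d Ag Hd) L)). pose proof (C_lt _ _ (proj1 Hd)). ord. }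
  rewrite <- (H5 g Ag i), <- E in Fg.
  assert (Cgb : C g b). { apply (C_coherent a g Ag). auto. }
  (* [m] lies beyond both the start of the block and the point from which the node follows [C g];
     the $J$-step after [m] ends inside the block. *)
  assert (exists m, C g m /\ b ≼ m /\ b1 ≼ m) as [m [Cm [Lbm Lb1m]]].
  { destruct (classic (b ≺ b1)) as [L|L].
    - exists b1. repeat split; auto using le_refl. left; exact L.
    - exists b. repeat split; auto using le_refl. ord. }
  destruct (consec_next g m Lg Cm) as [e He]. pose proof He as [_ [Ce [Lme _]]].
  pose proof (C_lt _ _ Ce) as Leg.
  exists m, e. split; [exact Lme|]. split; [ord|]. split.
  - assert (Ce' : C a e). { apply (C_coherent a g Ag). exact Ce. }
    assert (Lbe : b ≺ e) by ord.
    apply HG. split; [split; [exact Ce'|left; exact Lbe]|]. split.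
    + exists b. split; [split; [exact Hb|apply le_refl]|exact Lbe].
    + apply finite_between; auto; [left; exact Lbe|]. intros d Hd L.
      pose proof (Mg d (conj Hd L)). ord.
  - pose proof (Fg m e He Lb1m) as Q. rewrite !restr_restr in Q; [exact Q|left; ord|left; exact Leg].
Qed.

(** All elements of [A] turn out to have height at most one [a], so that [A] lies in a small union
    of small levels. *)
Lemma tree_antichain_small (A : node -> Prop) :
  (forall G, unbounded lt G ->
     stationary lt (fun a => E_ge lt chi a /\
       is_sup lt (fun b => C a b /\ forall d, succ_omega lt (fun c => C a c /\ b ≼ c) d -> G d) a)) ->
  antichain tree A -> small A.
Proof.
  intros HP [AT Aanti].
  (* [h b] will bound the codes of the nodes of height [b] and, for each such node with an extension
     in [A], the height of one such extension. *)
  assert (Hh : forall b, exists m, forall x, T b x -> pi x ≺ m /\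
     ((exists z, A z /\ sub x z) -> exists z e, A z /\ sub x z /\ T e z /\ e ≺ m)).
  { intros b. destruct inhabited_index as [k0].
    destruct (choice_on k0 (T b) (fun x m => pi x ≺ m /\
     ((exists z, A z /\ sub x z) -> exists z e, A z /\ sub x z /\ T e z /\ e ≺ m))) as [q Hq].
    - intros x Hx. destruct (classic (exists z, A z /\ sub x z)) as [[z [Az Sz]]|N].
      + destruct (AT z Az) as [e He]. destruct (exists_upper2 (pi x) e) as [m [M1 M2]].
        exists m. split; [exact M1|]. intros _. exists z, e. auto.
      + destruct (exists_gt (pi x)) as [m Hm]. exists m. tauto.
    - destruct (small_fun_bounded _ q (T_small b)) as [m Hm]. exists m. intros x Hx.
      destruct (Hq x Hx) as [Q1 Q2]. pose proof (Hm x Hx). split; [ord|].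
      intros E. destruct (Q2 E) as [z [e [H1 [H2 [H3 H4]]]]]. exists z, e.
      repeat split; auto. ord. }
  destruct (choice _ Hh) as [h Hh']. clear Hh.
  pose (X := fun k => exists z, A z /\ k = pi z).
  pose (G := fun g => (forall b, b ≺ g -> h b ≺ g) /\ forall b, b ≺ g -> (X b <-> As g b)).
  assert (UG : unbounded lt G).
  { intros a. destruct (As_guess X _ (club_closed_under h a)) as [g [[G1 G2] G3]].
    exists g. split; [split; assumption|exact G1]. }
  destruct inhabited_index as [k0].
  destruct (HP G UG _ (club_closed_under h k0)) as [a [_ [Ga Hsup]]].
  apply (small_incl _ (fun z => exists e, e ≼ a /\ T e z)).
  2: { apply (small_union (fun e => e ≼ a)); [apply seg_le_small|]. intros e _. apply T_small. }
  intros z Az. destruct (AT z Az) as [e He]. exists e. split; [|exact He].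
  apply not_lt. intros Lae.
  assert (Hza : T a (restr z a)). { apply (T_restr e); [exact He|left; exact Lae]. }
  destruct (level_jumps G a (restr z a) Ga Hsup Hza) as [d [g [Ldg [Lga [[G1 G2] EJ]]]]].
  assert (Ldga : d ≼ a) by (left; ord).
  rewrite !restr_restr in EJ; [|exact Ldga|left; exact Lga].
  assert (Hzd : T d (restr z d)). { apply (T_restr e); [exact He|left; ord]. }
  destruct (J_spec g d (restr z d) (all_extendible g) (or_introl Ldg) Hzd) as [J1 [J2 J3]].
  destruct J3 as [b [Lb Hb]].
  (* A hitting extension exists: closure of [g] under [h] yields an element [z'] of [A] below [g]
     extending [z] restricted to [d], and [z'] extends further to height [g]. *)
  - destruct (proj2 (Hh' d (restr z d) Hzd)) as [z' [e' [Az' [Sz' [He' Le']]]]].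
    { exists z. split; [exact Az|apply sub_restr]. }
    pose proof (G1 d Ldg) as Lhd. assert (Leg : e' ≺ g) by ord.
    destruct (all_extendible g e' z' (or_introl Leg) He') as [w [Hw Rw]].
    exists w. split; [exact Hw|]. split.
    + pose proof (sub_level _ _ _ _ (T_node _ _ Hzd) (T_node _ _ He') Sz') as Lde.
      rewrite <- (restr_restr w d e' Lde), Rw. apply sub_eq_restr; [exact (T_node _ _ Hzd)|exact Sz'].
    + exists e'. split; [exact Leg|]. rewrite Rw. apply G2.
      * pose proof (proj1 (Hh' e' z' He')). pose proof (G1 e' Leg). ord.
      * exists z'. auto.
  (* Since [z] passes through the $J$-step at [g], it has a guessed initial segment at [b]. The
     guess is correct there, so this proper initial segment of [z] is itself in [A]. *)
  - rewrite <- EJ, restr_restr in Hb by (left; exact Lb).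
    assert (Lbe : b ≺ e) by ord.
    assert (Hzb : T b (restr z b)). { apply (T_restr e); [exact He|left; exact Lbe]. }
    apply G2 in Hb.
    + destruct Hb as [z' [Az' Epi]].
      assert (E : restr z b = z').
      { apply pi_inj; [exists b; exact (T_node _ _ Hzb)| |exact Epi].
        destruct (AT z' Az') as [e' He']. exists e'. exact (T_node _ _ He'). }
      pose proof (strict_sub_of_restr _ _ _ _ (T_node _ _ Hzb) (T_node _ _ He) Lbe eq_refl) as S.
      rewrite E in S. apply (Aanti z' z Az' Az); [|exact S]. apply S.
    + pose proof (proj1 (Hh' b _ Hzb)). pose proof (G1 b Lb). ord.
Qed.

(** The nodes that leave a cofinal branch at each height, with a last value differing from that of
    the branch, would form an antichain of size $\kappa$. *)
Lemma tree_no_cofinal_branch :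
  (forall A, antichain tree A -> small A) -> ~ has_cofinal_branch lt tree.
Proof.
  intros HA [b Hb].
  assert (Hv : forall w, exists v, v ≺ chi /\ v <> w).
  { intros w. destruct (proj1 Hchi) as [q [Hq Iq]].
    destruct (classic (q 0 = w)) as [E|E]; [exists (q 1)|exists (q 0)]; (split; [apply Hq; exact I|]); auto.
    intros E'. assert (0 = 1) by (apply Iq; auto; congruence). discriminate. }
  pose (off := fun a y => exists x v a', T a x /\ restricts lt x b a /\ v ≺ chi /\ v <> b a /\
                 is_succ a a' /\ y = extend x a v).
  assert (Hoff : forall a y, off a y -> exists a', is_succ a a' /\ T a' y).
  { intros a y [x [v [a' [Hx [_ [Lv [_ [Ha' ->]]]]]]]]. exists a'. split; [exact Ha'|].
    apply T_extend; auto. destruct (Hlab a) as [H _]. ord. }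
  apply (HA (fun y => exists a, off a y)).
  - split.
    + intros y [a Hy]. destruct (Hoff a y Hy) as [a' [_ H]]. exists a'. exact H.
    + intros y y' [a Hy] [a' Hy'] NE [S _].
      destruct (Hoff a y Hy) as [s [Hs Ts]], (Hoff a' y' Hy') as [s' [Hs' Ts']].
      pose proof (sub_level _ _ _ _ (T_node _ _ Ts) (T_node _ _ Ts') S) as L.
      destruct (lt_total a a') as [La|[<-|La]].
      * destruct Hy as [x [v [_ [_ [_ [_ [Nv [_ ->]]]]]]]].
        destruct Hy' as [x' [v' [_ [_ [[_ Hx'] [_ [_ [_ ->]]]]]]]].
        apply Nv. pose proof (S a v (extend_at x a v)) as E. unfold extend in E.
        destruct (excluded_middle_informative (a = a')) as [->|_]; [destruct (lt_irrefl _ La)|].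
        rewrite (Hx' a La) in E. congruence.
      * apply NE. rewrite <- (restr_id _ _ (T_node _ _ Ts')).
        assert (s' = s) as ->.
        { destruct Hs as [S1 S2], Hs' as [S3 S4]. apply le_antisym; auto. }
        symmetry. apply sub_eq_restr; [exact (T_node _ _ Ts)|exact S].
      * destruct Hs as [S1 S2], Hs' as [S3 S4]. specialize (S4 _ La). ord.
  - assert (Hc : forall a, exists y, off a y).
    { intros a. destruct (Hb a) as [x [Tx Rx]]. destruct (Hv (b a)) as [v [V1 V2]].
      destruct (succ_exists a) as [a' Ha']. exists (extend x a v), x, v, a'.
      repeat split; auto; try apply Ha'; try apply Rx. exact (T_of_tree _ _ Tx (proj1 Rx)). }
    destruct (choice _ Hc) as [y Hy]. exists y. split; [intros a _; exists a; auto|].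
    intros a a' _ _ E. destruct (Hoff _ _ (Hy a)) as [s [Hs Ts]], (Hoff _ _ (Hy a')) as [s' [Hs' Ts']].
    rewrite E in Ts. pose proof (node_level_unique _ _ _ (T_node _ _ Ts) (T_node _ _ Ts')) as <-.
    exact (is_succ_inj _ _ _ Hs Hs').
Qed.

(** * The ascent path *)

Lemma F_succ a b u i : U u -> is_node lt u a -> is_succ b a -> F a u i b = Some (lab b u i).
Proof. intros Uu Nu Hb. destruct (all_ascends a u Uu Nu) as [_ [_ [H _]]]. apply H, Hb. Qed.

(** Almost every branch of the path at [u] records at height [b] the label of [u] restricted to
    [b']. Labels being injective, paths at nodes that differ at [b] are separated there. *)
Lemma F_eventually_succ u a b b' : U u -> is_node lt u a -> is_succ b b' -> b ≺ a ->
  cofinite (fun i => F a u i b = Some (lab b (restr u b') i)).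
Proof.
  intros Uu Nu Hb Lb. pose proof (proj2 Hb a Lb) as L.
  assert (Ub : U (restr u b')). { apply (U_restr u a); auto. }
  assert (Nb : is_node lt (restr u b') b'). { apply (restr_node u a); auto. }
  destruct L as [L| ->].
  - destruct (all_ascends a u Uu Nu) as [_ [H _]].
    apply (cofinite_mono _ _) with (2 := H b' L). intros i E.
    rewrite <- (F_succ b' b _ i Ub Nb Hb), <- E. symmetry. apply restr_lt. apply Hb.
  - exists 0. intros i _. rewrite (restr_id _ _ Nu) in *. apply F_succ; auto.
Qed.

(** A node does not carry its height explicitly, so a function [height] selects the stage from which
    the path value is taken. *)
Lemma tree_ascent_path (height : node -> K) :
  (forall u a, is_node lt u a -> height u = a) ->
  injective_ascent_path lt tree U (fun u => F (height u) u).
Proof.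
  intros Hht. split; [split; [|split]|].
  - intros u a Uu Nu i. rewrite (Hht u a Nu). apply level_tree, F_T; auto. apply all_ascends.
  - intros u v Uu Uv [S NE].
    destruct (proj1 (proj1 HU) u Uu) as [a Nu], (proj1 (proj1 HU) v Uv) as [b Nv].
    rewrite (Hht u a Nu), (Hht v b Nv).
    pose proof (sub_eq_restr _ _ _ Nu S) as Eu.
    destruct (sub_level _ _ _ _ Nu Nv S) as [L| ->].
    2: { destruct NE. rewrite <- Eu. exact (restr_id _ _ Nv). }
    destruct (all_ascends b v Uv Nv) as [_ [H _]].
    apply (cofinite_mono _ _) with (2 := H a L). intros i E. rewrite Eu in E.
    apply (strict_sub_of_restr _ _ a b); auto; apply F_node; auto; apply all_ascends.
  - intros u v a Uu Uv Nu Nv NE. rewrite (Hht u a Nu), (Hht v a Nv).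
    assert (exists b, b ≺ a /\ u b <> v b) as [b [Lb Hb]].
    { apply NNPP. intros N. apply NE. apply (node_ext _ _ a); auto. intros c Lc.
      apply NNPP. intros Hc. apply N. exists c. auto. }
    destruct (succ_exists b) as [b' Hb'].
    pose proof (F_eventually_succ u a b b' Uu Nu Hb' Lb) as H1.
    pose proof (F_eventually_succ v a b b' Uv Nv Hb' Lb) as H2.
    apply (cofinite_mono _ _) with (2 := cofinite_and _ _ H1 H2). intros i [E1 E2] E.
    rewrite E, E2 in E1. injection E1 as E1.
    pose proof (proj2 Hb' a Lb) as L.
    apply (proj2 (proj2 (Hlab b)) b' Hb') in E1; try apply (U_restr _ a); try apply (restr_node _ a); auto.
    destruct E1 as [E1 _]. apply Hb.
    rewrite <- (restr_lt u b' b (proj1 Hb')), <- (restr_lt v b' b (proj1 Hb')), E1. reflexivity.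
  (* Any successor height works with [N = 0], since the labels of a node at that height differ for
     all indices. *)
  - intros b Hb. destruct inhabited_index as [k0]. destruct (succ_exists k0) as [a Ha].
    destruct (Hb a) as [x [Ux Rx]]. exists a, x. split; [exact Ux|]. split; [exact Rx|].
    destruct Rx as [Nx _]. rewrite (Hht x a Nx).
    exists 0. intros i j _ _ E.
    pose proof (F_succ a k0 x i Ux Nx Ha) as E1. rewrite E, (F_succ a k0 x j Ux Nx Ha) in E1.
    injection E1 as E1. symmetry. apply (proj2 (proj2 (Hlab k0)) a Ha) in E1; auto. apply E1.
Qed.

Lemma height_exists : exists h : node -> K, forall u a, is_node lt u a -> h u = a.
Proof.
  destruct inhabited_index as [k0].
  destruct (choice_on k0 (Node lt) (is_node lt) (fun u H => H)) as [h Hh].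
  exists h. intros u a Nu. apply (node_level_unique u); [|exact Nu]. apply Hh. exists a. exact Nu.
Qed.

End Regular.

Theorem theorem4p3 (K : Type) (lt : K -> K -> Prop) (chi : K) (U : @node K -> Prop) :
  regular_uncountable lt ->
  infinite_cardinal lt chi ->
  kappa_tree lt U ->
  P14 lt (E_ge lt chi) ->
  (forall lam : K, small_power lt lam chi) ->
  exists T : @node K -> Prop,
    prolific lt T /\ chi_complete lt chi T /\ souslin lt T /\
    exists f : @node K -> nat -> @node K, injective_ascent_path lt T U f.
Proof.
  intros HR Hchi HU [Hd [C [C_lt [C_club [C_coh HP]]]]] Hpow.
  destruct (node_code lt HR Hd) as [pi pi_inj].
  destruct Hd as [As [_ As_guess]].
  destruct (labels_exist lt HR chi U HU) as [mu [lab Hlab]].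
  destruct (height_exists lt HR) as [h Hh].
  (* Smallness of antichains comes first because the absence of cofinal branches is derived from
     it. *)
  assert (HA : forall A, antichain (tree lt HR C chi U As pi mu lab) A -> ~ card_le (@fullK K) A).
  { intros A. apply tree_antichain_small; auto. }
  exists (tree lt HR C chi U As pi mu lab). split; [|split; [|split]].
  - apply tree_prolific; auto.
  - apply tree_chi_complete; auto.
  - split; [apply tree_kappa_tree; auto|]. split; [|exact HA].
    apply tree_no_cofinal_branch; auto.
  - eexists. apply tree_ascent_path; eauto.
Qed.
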